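(* Let $K$ be a totally real number field of degree $n$ over $\mathbb{Q}$ with regulator $R_K$ and discriminant $\Delta_K$. If $$\frac{|\Delta_K|}{1+\frac12 e^{\frac{2}{\sqrt n}R_K^{\frac{1}{n-1}}}}\le\frac{\left(\frac{n\pi}{4}\right)^n}{\Gamma\left(\frac n2+1\right)^2},$$ then $K$ is not unit reducible.
   Context: For a totally real number field $K$ with ring of integers $\mathcal{O}_K$ and unit group $\mathcal{O}_K^\times$, let $K_{>>0}$ be the set of totally positive elements and, for $a\in K_{>>0}$, $\mu(a)=\min_{x\in\mathcal{O}_K\setminus\{0\}}\mathrm{Tr}_{K/\mathbb{Q}}(ax^2)$. $K$ is called unit reducible if $\mu(a)=\min_{u\in\mathcal{O}_K^\times}\mathrm{Tr}_{K/\mathbb{Q}}(au^2)$ for all $a\in K_{>>0}$. $\Gamma$ is the gamma function. *)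

(* Defs.v *)
From HB Require Import structures.
From mathcomp Require Import all_boot all_order all_algebra all_field.
From mathcomp Require Import all_classical all_reals all_analysis.

Set Implicit Arguments.
Unset Strict Implicit.
Unset Printing Implicit Defensive.

Import Order.TTheory GRing.Theory Num.Theory.
Local Open Scope ring_scope.

Section NumberField.
Variable L : fieldExtType rat.

Definition is_integral (x : L) : Prop :=
  exists p : {poly int}, p \is monic /\ root (map_poly (fun z : int => z%:~R) p) x.

Definition is_unitK (x : L) : Prop :=
  x != 0 /\ is_integral x /\ is_integral x^-1.

Definition traceK (x : L) : rat :=
  \tr (passmx.mxof (vbasis {:L}) (vbasis {:L}) (amull x)).

Definition totally_real : Prop :=
  forall (f : {rmorphism L -> algC}) (x : L), f x \is Num.real.

Definition totally_positive (a : L) : Prop :=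
  forall f : {rmorphism L -> algC}, 0 < f a.

Definition unit_reducible : Prop :=
  forall a : L, totally_positive a ->
    exists u : L, is_unitK u /\
      forall x : L, is_integral x -> x != 0 ->
        (traceK (a * u ^+ 2) <= traceK (a * x ^+ 2))%R.

(* b is an integral basis (Z-basis of O_L); n = [L : Q]. *)
Definition integral_basis (n : nat) (b : 'I_n -> L) : Prop :=
  (forall i, is_integral (b i)) /\
  (forall x, is_integral x -> exists c : 'I_n -> int, x = \sum_i (c i)%:~R * b i).

Definition disc_of_basis (n : nat) (b : 'I_n -> L) : rat :=
  \det (\matrix_(i < n, j < n) traceK (b i * b j)).

(* eps is a system of fundamental units (units of a totally real field
   have torsion {1,-1}). *)
Definition fundamental_units (m : nat) (eps : 'I_m -> L) : Prop :=
  (forall j, is_unitK (eps j)) /\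
  (forall u, is_unitK u -> exists (s : bool) (k : 'I_m -> int),
      u = (-1) ^+ s * \prod_j (eps j) ^ (k j)).

Definition real_embeddings (R : realType) (n : nat)
  (sigma : 'I_n -> {rmorphism L -> R}) : Prop :=
  forall i j, (forall x, sigma i x = sigma j x) -> i = j.

Definition regulator_of (R : realType) (n : nat)
  (sigma : 'I_n -> {rmorphism L -> R}) (eps : 'I_n.-1 -> L) : R :=
  `| \det (\matrix_(i < n.-1, j < n.-1)
            ln `| sigma (widen_ord (leq_pred n) i) (eps j) |) |.

End NumberField.

Definition Gamma (R : realType) (s : R) : R :=
  fine (\int[@lebesgue_measure R]_(t in `]0%R, +oo[%classic)
          ((powR t (s - 1)) * expR (- t))%:E)%E.

(* Main.v *)
(** If [K] is unit reducible then, for a totally positive [a], the quadratic form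
    [x |-> Tr(a x^2)] on the integers of [K], of determinant [N(a) Delta], attains
    its minimum at a unit, so Hermite's inequality
    [min^n <= (4/3)^(n(n-1)/2) N(a) Delta] bounds [Delta] below by the values of
    [Tr(a u^2)] at units.  Take [a = c^2], where [c] approximates a point of [R^n]
    whose logarithm is a deep hole of the lattice [2 log |u|] relative to the
    simplex gauge [max_k v_k]: a volume count shows that every [u] has a conjugate
    of [a u^2] larger than [e^r] as soon as [(n r)^(n-1) < (n-1)! 2^(n-1) Reg], and
    then [Tr(a u^2) >= e^r + (n-1) e^(-r/(n-1))].  This handles large regulators;
    for small ones Minkowski's bound [n^n / n! <= sqrt Delta] suffices.  Both
    geometric facts are obtained by counting cosets of the integer matrices
    [floor (N A)] and letting [N] grow.  In degree 2 the two estimates do not meet,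
    and the discriminants 5 and 8 are treated through explicit units. *)

Require Import Defs.
From HB Require Import structures.
From mathcomp Require Import all_boot all_order all_algebra all_field.
From mathcomp Require Import all_classical all_reals all_analysis.
From mathcomp Require Import measurable_realfun zify ring lra.
Set Implicit Arguments.
Unset Strict Implicit.
Unset Printing Implicit Defensive.
Import Order.TTheory GRing.Theory Num.Theory.
Import numFieldNormedType.Exports.
Local Open Scope classical_set_scope.
Local Open Scope ring_scope.

(** * Cosets of an integer matrix *)

(** Put [m = n - 1], [x = (2 / sqrt n) Reg^(1/m)] and [y = e^x]. The hypothesis reads
    [Delta <= c (1 + y/2)], with [c] its right-hand side: a bound linear in [y]. Taking
    [r = kappa x / n] removes the regulator from the volume condition, which becomes
    [kappa^(2m) < m!^2 n^m], and Hermite's inequality then gives at least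
    [y^kappa <= (4/3)^(n m / 2) Delta]. Some [kappa > 1] is allowed in every degree (7/5, 12/5, 7/2,
    then [m]), so the two bounds conflict for large [y], and a lower bound on [Delta] must exclude
    the small [y]. Making these ranges overlap is the numerical difficulty: degrees 2, 3 and 4 have
    constants of their own, the others follow from an induction.

    Two things hold only approximately: [c^2] has to come from the field, so it is merely close to
    the deep hole, and the infimum of a form is not shown to be attained, so Hermite's constant is
    any number above 4/3. One slack parameter [d] measures both losses and tends to 0 at the end. *)

Lemma int_mx_cosets m (B : 'M[int]_m) : \det B != 0 ->
  exists (T : finType) (f : 'rV[int]_m -> T),
  [/\ #|T| = `|\det B|%N,
      forall z w, f z = f w -> exists k, z = w + k *m B,
      forall z k, f (z + k *m B) = f z &
      forall t, exists z, f z = t].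
Proof.
(* In Smith form [B = U D V], the map [z |-> z V^-1] carries the row lattice of [B] onto that of the
   diagonal [D], since [U] is unimodular. A coset is then named by residues modulo the diagonal
   entries. *)
move=> detB; have [U Uu [V Vu [d _ DB]]] := int_Smith_normal_form B.
pose e (i : 'I_m) : int := d`_i; pose D : 'M[int]_m := diag_mx (\row_i e i).
have {}DB : B = U *m D *m V.
  rewrite {1}DB; congr (_ *m _ *m _); apply/matrixP=> i j.
  by rewrite !mxE.
have absU (W : 'M[int]_m) : W \in unitmx -> `|\det W|%N = 1%N.
  by rewrite unitmxE => /orP[]/eqP->.
have detD : `|\det B|%N = (\prod_(i < m) `|e i|)%N.
  rewrite DB !det_mulmx !abszM (absU U) // (absU V) // mul1n muln1 det_diag.
  rewrite (big_morph _ abszM (erefl : `|1|%N = 1%N)).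
  by apply: eq_bigr => i _; rewrite mxE.
have d0 i : (0 < `|e i|)%N.
  rewrite absz_gt0; apply: contraNneq detB => di0.
  by rewrite -absz_eq0 detD (bigD1 i) //= di0 mul0n.
pose fT := {dffun forall i : 'I_m, 'I_(`|e i|)}.
have lt_mod (i : 'I_m) (z : int) : (`|(z %% e i)%Z| < `|e i|)%N.
  have di0 : e i != 0 by rewrite -absz_gt0.
  by rewrite -ltz_nat gez0_abs ?modz_ge0 // abszE ltz_mod.
pose g (z : 'rV[int]_m) := z *m invmx V.
pose f (z : 'rV[int]_m) : fT :=
  [ffun i : 'I_m => Ordinal (lt_mod i (g z 0%R i))].
exists fT, f; split=> [|z w fzw|z k|t].
- rewrite card_dep_ffun foldrE big_image detD /=.
  by apply: eq_bigr => i _; rewrite card_ord.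
- have dv i : (e i %| g z 0%R i - g w 0%R i)%Z.
    have di0 : e i != 0 by rewrite -absz_gt0.
    rewrite -eqz_mod_dvd; apply/eqP.
    have := congr1 (fun g : fT => g i : nat) fzw; rewrite !ffunE /= => /(congr1 Posz).
    by rewrite !gez0_abs ?modz_ge0.
  have [q Dq] : exists q, q *m D = g z - g w.
    move: (g z) (g w) dv => a c dv.
    exists (\row_i ((a 0%R i - c 0%R i) %/ e i)%Z); apply/rowP=> i.
    by rewrite mul_mx_diag !mxE divzK.
  exists (q *m invmx U); rewrite DB -!mulmxA mulKmx // mulmxA Dq.
  by rewrite -mulmxBl mulmxKV // addrC subrK.
- apply/ffunP=> i; rewrite !ffunE; apply: val_inj => /=; congr `|_|%N.
  apply/eqP; rewrite eqz_mod_dvd /g mulmxDl mxE addrAC subrr add0r.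
  by rewrite DB !mulmxA mulmxK // mul_mx_diag !mxE dvdz_mull.
exists ((\row_i (t i : nat)%:Z) *m V); apply/ffunP=> i; rewrite ffunE; apply: val_inj => /=.
by rewrite /g mulmxK // mxE -modz_abs modz_small //= ltz_nat ltn_ord.
Qed.

Lemma int_mx_pigeonhole m (B : 'M[int]_m) (I : finType) (s : I -> 'rV[int]_m) :
  \det B != 0 -> (`|\det B| < #|I|)%N ->
  exists i j k, i != j /\ s i = s j + k *m B.
Proof.
move=> /int_mx_cosets[T [f [cT f_eq _ _]]] ltI.
have /injectivePn[i [j neq_ij fij]] : ~~ injectiveb (f \o s).
  by apply/negP=> /injectiveP/leq_card; rewrite cT leqNgt ltI.
by have [k Dk] := f_eq _ _ fij; exists i, j, k.
Qed.

Lemma int_mx_missed_coset m (B : 'M[int]_m) (I : finType) (s : I -> 'rV[int]_m) :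
  (#|I| < `|\det B|)%N -> exists z, forall i k, z + k *m B != s i.
Proof.
move=> ltI; have detB : \det B != 0 by rewrite -absz_gt0 (leq_trans _ ltI).
have [T [f [cT _ fD f_onto]]] := int_mx_cosets detB.
have [t tP] : exists t, forall i, f (s i) != t.
  case: (pickP [pred t | [forall i, f (s i) != t]]) => [t /forallP|no_t]; first by exists t.
  have: (#|T| <= #|codom (f \o s)|)%N.
    apply/subset_leq_card/fintype.subsetP=> t _; have /forallPn[i] := negbT (no_t t).
    by rewrite negbK => /eqP <-; apply: (codom_f (f \o s)).
  by rewrite cT leqNgt (leq_ltn_trans (leq_image_card _ _) ltI).
have [z fz] := f_onto t; exists z => i k.
by apply: contra_neq (tP i) => <-; rewrite fD.
Qed.

(** * Packing and covering by lattice translates *)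

Section LatticeCounting.
Variable R : realType.
Implicit Types (m n N : nat).

Definition l1 n (v : 'rV[R]_n) : R := \sum_j `|v 0 j|.

(** Rounding [N A] makes the lattice integral, so that its covolume is a number of cosets; the error
    is at most 1 per entry and disappears after division by [N]. *)
Definition floor_mx m n N (A : 'M[R]_(m, n)) : 'M[int]_(m, n) :=
  \matrix_(i, j) Num.floor (N%:R * A i j).

Lemma l1D n (v w : 'rV[R]_n) : l1 (v + w) <= l1 v + l1 w.
Proof. by rewrite -big_split ler_sum // => j _; rewrite mxE ler_normD. Qed.

Lemma l1N n (v : 'rV[R]_n) : l1 (- v) = l1 v.
Proof. by apply: eq_bigr => j _; rewrite mxE normrN. Qed.

Lemma le_l1 n (v : 'rV[R]_n) j : `|v 0 j| <= l1 v.
Proof. by rewrite /l1 (bigD1 j) //= lerDl sumr_ge0. Qed.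

Lemma l1_mulmx m n (v : 'rV[R]_m) (A : 'M[R]_(m, n)) (c : R) :
  (forall i j, `|A i j| <= c) -> l1 (v *m A) <= n%:R * c * l1 v.
Proof.
move=> Ac; have cv j : `|(v *m A) 0 j| <= c * l1 v.
  rewrite mxE (le_trans (ler_norm_sum _ _ _)) // mulr_sumr ler_sum // => i _.
  by rewrite normrM mulrC ler_wpM2r.
rewrite (le_trans (ler_sum _ (fun j _ => cv j))) //.
by rewrite sumr_const card_ord -mulrA mulr_natl.
Qed.

(** Bounds the coefficients of a lattice vector by its size, hence the effect of rounding the
    matrix. *)
Lemma l1_le_mulmx n (A : 'M[R]_n) : A \in unitmx ->
  exists2 K : R, 0 <= K & forall v : 'rV_n, l1 v <= K * l1 (v *m A).
Proof.
move=> Au; pose c := \sum_i \sum_j `|invmx A i j|.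
have c0 : 0 <= c by apply: sumr_ge0 => i _; apply: sumr_ge0.
exists (n%:R * c); first by rewrite mulr_ge0.
move=> v; rewrite -{1}[v](mulmxK Au); apply: l1_mulmx => i j.
rewrite /c (bigD1 i) //= (bigD1 j) //= -addrA lerDl addr_ge0 ?sumr_ge0 // => *.
exact: sumr_ge0.
Qed.

Lemma cvg_det (T : Type) (F : set_system T) n (A_ : T -> 'M[R]_n) (A : 'M[R]_n) :
  Filter F -> (forall i j, A_ t i j @[t --> F] --> A i j) ->
  \det (A_ t) @[t --> F] --> \det A.
Proof.
move=> FF AA; rewrite /determinant; apply: cvg_big => [|s _]; first exact: add_continuous.
apply: cvgM; first exact: cvg_cst.
apply: cvg_big => [|i _]; last exact: AA.
exact: mul_continuous.
Qed.

Lemma floor_mx_close m n N (A : 'M[R]_(m, n)) i j :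
  `|map_mx intr (floor_mx N A) i j - N%:R * A i j| <= 1.
Proof.
rewrite !mxE distrC ger0_norm ?subr_ge0 ?floor_le // lerBlDl.
by have := floorD1_gt (N%:R * A i j); rewrite intrD => /ltW.
Qed.

Lemma cvg_det_floor_mx n (A : 'M[R]_n) :
  \det (map_mx intr (floor_mx N.+1 A)) / N.+1%:R ^+ n @[N --> \oo] --> \det A.
Proof.
have E N : \det (map_mx intr (floor_mx N.+1 A)) / N.+1%:R ^+ n
    = \det (N.+1%:R^-1 *: (map_mx intr (floor_mx N.+1 A) : 'M[R]_n)).
  by rewrite detZ exprVn mulrC.
under eq_cvg do rewrite E.
apply: cvg_det => i j; apply/cvgrPdist_le => e e0.
have : \forall N \near \oo, `|0 - @harmonic R N| <= e.
  by move/cvgrPdist_le : (@cvg_harmonic R); apply.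
apply: filterS => N; rewrite sub0r normrN /harmonic ger0_norm ?invr_ge0 //.
apply: le_trans; rewrite distrC mxE.
have N0 : N.+1%:R != 0 :> R by [].
have -> : A i j = N.+1%:R^-1 * (N.+1%:R * A i j) by rewrite mulKf.
rewrite -mulrBr normrM ger0_norm ?invr_ge0 // ler_piMr ?invr_ge0 //.
exact: floor_mx_close.
Qed.

Lemma det_map_int n (B : 'M[int]_n) :
  `|\det (map_mx intr B : 'M[R]_n)| = `|\det B|%N%:R.
Proof. by rewrite natr_absz det_map_mx intr_norm. Qed.

End LatticeCounting.

(** The left factor times [m!] is the product of the integers from [T + 1] to [T + m]. With the next
    lemma, the simplex of size [T] has about [T^m / m!] lattice points, which replaces its
    volume. *)
Lemma ffact_simplex_ge m T : (T.+1 ^ m <= 'C(m + T, m) * m`!)%N.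
Proof.
rewrite bin_ffact ffact_prod -{1}[m]card_ord -prod_nat_const leq_prod // => i _.
by rewrite ltn_subRL ltn_add2r.
Qed.

Lemma ffact_simplex_le m T : ('C(m + T, m) * m`! <= (m + T) ^ m)%N.
Proof.
rewrite bin_ffact ffact_prod -[X in (_ <= _ ^ X)%N]card_ord -prod_nat_const.
by rewrite leq_prod // => i _; rewrite leq_subr.
Qed.

Section PackingCovering.
Variable R : realType.

Definition simplex m T := {t : m.-tuple 'I_T.+1 | (\sum_(i <- t) i <= T)%N}.

Lemma card_simplex m T : #|{: simplex m T}| = 'C(m + T, m).
Proof. by rewrite -card_partial_ord_partitions card_sig cardsE. Qed.

Lemma near_inv_lt (c e : R) : 0 < e -> \forall N \near \oo, c / N.+1%:R < e.
Proof.
move=> e0; have : c * harmonic N @[N --> \oo] --> c * 0.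
  by apply: cvgM; [exact: cvg_cst | exact: cvg_harmonic].
by rewrite mulr0 => /cvgr_lt; apply.
Qed.

(** The shift by one keeps all coordinates nonzero, so the signs can be recovered and the [2^n]
    reflected simplices are disjoint. They fill the octahedron of radius [T + n] up to lower-order
    terms. *)
Definition signed_point n T (p : simplex n T * {ffun 'I_n -> bool}) : 'rV[int]_n :=
  \row_j ((-1) ^+ p.2 j * (tnth (val p.1) j).+1%:Z).

Lemma signed_point_inj n T : injective (@signed_point n T).
Proof.
move=> [t f] [u g] /rowP eq_tu.
have abs_eq j : tnth (val t) j = tnth (val u) j.
  have := congr1 absz (eq_tu j); rewrite !mxE !abszM !abszX !exp1n !mul1n /=.
  by case=> /val_inj.
congr pair; first by apply/val_inj/eq_from_tnth.
apply/ffunP=> j; have := eq_tu j; rewrite !mxE /= abs_eq.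
by case: (f j) (g j) => [] [] //; rewrite ?expr0 ?expr1 ?mul1r ?mulN1r.
Qed.

Lemma l1_signed_point n T (p : simplex n T * {ffun 'I_n -> bool}) :
  l1 (map_mx intr (signed_point p)) <= (T + n)%:R :> R.
Proof.
have E j : `|map_mx intr (signed_point p) 0 j : R| = (tnth (val p.1) j).+1%:R.
  by rewrite !mxE rmorphM normrM rmorphXn normrX /= normrN1 expr1n mul1r normr_nat.
rewrite /l1 (eq_bigr _ (fun j _ => E j)) -natr_sum ler_nat.
under eq_bigr do rewrite -addn1.
rewrite big_split /= sum1_card card_ord leq_add2r.
by case: (p.1) => t /=; rewrite big_tuple.
Qed.

(** Octahedra of radius [l / 2] about the lattice points have disjoint interiors, and each has
    volume [l^n / n!]. If the bound failed, then for large [N] the integer points of norm about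
    [N l / 2] would outnumber the cosets of the rounded lattice, and two congruent ones would differ
    by too short a vector. *)
Lemma lattice_packing n (E : 'M[R]_n) (l : R) : \det E != 0 -> 0 <= l ->
  (forall x : 'rV[int]_n, x != 0 -> l <= l1 (map_mx intr x *m E)) ->
  l ^+ n <= n`!%:R * `|\det E|.
Proof.
case: n E => [|n] E detE l_ge0 lE; first by rewrite det_mx00 normr1 mulr1 expr0 fact0.
set m := n.+1 in E detE lE *; rewrite leNgt; apply/negP => lt_det.
have l0 : 0 < l.
  rewrite lt_neqAle l_ge0 andbT; apply/eqP => l0; move: lt_det; apply/negP.
  by rewrite -l0 /m exprS mul0r -leNgt mulr_ge0 ?ler0n.
have Eu : E \in unitmx by rewrite unitmxE unitfE.
have [K K0 KE] := l1_le_mulmx Eu.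
pose B N : 'M[R]_m := map_mx intr (floor_mx N.+1 E).
(* [2 X N = l (N - m K)] is the lower bound [N l] less the rounding loss. With
   [T = floor (X N) - (m + 1)] below, the difference of two points, of norm at most [2 (T + m)], is
   strictly shorter. *)
pose X N : R := l * (N.+1%:R - m%:R * K) / 2.
have cX : (2 * (X N - m.+1%:R) / N.+1%:R) ^+ m - m`!%:R * `|\det (B N) / N.+1%:R ^+ m|
    @[N --> \oo] --> l ^+ m - m`!%:R * `|\det E|.
  apply: cvgB.
    apply: (@continuous_cvg _ _ _ _ _ _ (fun x : R => x ^+ m)).
      exact: exprn_continuous.
    have -> : (fun N => 2 * (X N - m.+1%:R) / N.+1%:R) =
              (fun N => l - (l * m%:R * K + 2 * m.+1%:R) * harmonic N).
      apply/funext => N; rewrite /X /harmonic /=.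
      have : N.+1%:R != 0 :> R by rewrite pnatr_eq0.
      move: N.+1%:R m.+1%:R m%:R => a c d a0.
      by field.
    rewrite -[X in _ --> X]subr0; apply: cvgB; first exact: cvg_cst.
    rewrite -(mulr0 (l * m%:R * K + 2 * m.+1%:R)).
    by apply: cvgM; [exact: cvg_cst | exact: cvg_harmonic].
  apply: cvgM; first exact: cvg_cst.
  by apply: cvg_norm; exact: cvg_det_floor_mx.
have : \forall N \near \oo, False; last first.
  by move=> /filter_ex[].
near=> N.
have detB : 0 < `|\det (B N) / N.+1%:R ^+ m|.
  near: N; apply: (cvgr_gt `|\det E|); last by rewrite normr_gt0.
  by apply: cvg_norm; exact: cvg_det_floor_mx.
have X_ge : m.+2%:R <= X N.
  have : (m%:R * K + 2 * m.+2%:R / l) / N.+1%:R < 1 by near: N; apply: near_inv_lt.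
  rewrite ltr_pdivrMr // mul1r => XN.
  have : 2 * m.+2%:R / l < N.+1%:R - m%:R * K by lra.
  by rewrite ltr_pdivrMr // => XN2; rewrite /X; lra.
have big : 0 < (2 * (X N - m.+1%:R) / N.+1%:R) ^+ m - m`!%:R * `|\det (B N) / N.+1%:R ^+ m|.
  by near: N; apply: (cvgr_gt _ cX); rewrite subr_gt0.
have {big} big : m`!%:R * `|\det (B N)| < (2 * (X N - m.+1%:R)) ^+ m.
  move: big; rewrite subr_gt0 expr_div_n normrM normfV [`|_ ^+ _|]ger0_norm ?exprn_ge0 //.
  by rewrite mulrA ltr_pM2r // invr_gt0 exprn_gt0.
have X_ge0 : 0 <= X N by apply: le_trans X_ge.
have /andP[trX Xtr] := truncn_itv X_ge0.
pose T := (Num.truncn (X N) - m.+1)%N.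
have DT : (T + m.+1)%N = Num.truncn (X N).
  by rewrite subnK // truncn_ge_nat // (le_trans _ X_ge) // ler_nat.
rewrite -{}DT in trX Xtr.
have detBN0 : \det (floor_mx N.+1 E) != 0.
  move: detB; rewrite normr_gt0 mulf_eq0 negb_or => /andP[+ _].
  by rewrite /B det_map_mx intr_eq0.
have : (`|\det (floor_mx N.+1 E)| < #|{: simplex m T * {ffun 'I_m -> bool}}|)%N.
  rewrite card_prod card_simplex card_ffun card_bool card_ord.
  rewrite -(ltr_nat R) -(det_map_int R) -(ltr_pM2l (_ : 0 < m`!%:R)) ?ltr0n ?fact_gt0 //.
  apply: lt_le_trans big _; rewrite -natrM.
  apply: le_trans (_ : (2 * T.+1%:R) ^+ m <= _).
    have X0 : 0 <= X N - m.+1%:R by rewrite subr_ge0 (le_trans _ X_ge) // ler_nat.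
    have T0 : 0 <= T.+1%:R :> R by [].
    rewrite ler_pXn2r ?nnegrE ?mulr_ge0 //.
    by rewrite ler_pM2l // lerBlDr -natrD addSn ltW.
  rewrite -natrM -natrX ler_nat expnMn mulnA [leqRHS]mulnC leq_mul2l [(m`! * _)%N]mulnC.
  by rewrite ffact_simplex_ge orbT.
move=> /(int_mx_pigeonhole (@signed_point m T) detBN0)[i [j [k [neq_ij Dk]]]].
have k0 : k != 0.
  apply: contra_neq neq_ij => k0; apply: signed_point_inj.
  by rewrite Dk k0 mul0mx addr0.
have := lE k k0; set y : 'rV[R]_m := map_mx intr k => le_l.
have DkB : y *m B N = map_mx intr (signed_point i) - map_mx intr (signed_point j).
  by rewrite -map_mxM -map_mxB Dk addrAC subrr add0r.
have le1 : l1 (y *m B N) <= 2 * (T + m)%:R.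
  by rewrite DkB (le_trans (l1D _ _)) // l1N mulr_natl mulr2n lerD // l1_signed_point.
have le2 : N.+1%:R * l1 (y *m E) - m%:R * K * l1 (y *m E) <= l1 (y *m B N).
  have DE : N.+1%:R *: (y *m E) = y *m B N - y *m (B N - N.+1%:R *: E).
    by rewrite mulmxBr opprB addrCA subrr addr0 scalemxAr.
  have -> : N.+1%:R * l1 (y *m E) = l1 (N.+1%:R *: (y *m E)).
    rewrite mulr_sumr; apply: eq_bigr => q _.
    by rewrite [in RHS]mxE normrM normr_nat.
  rewrite lerBlDr DE (le_trans (l1D _ _)) // lerD2l l1N.
  apply: le_trans (l1_mulmx (c := 1) _ _) _ => [q1 q2|].
    by rewrite mxE [X in _ + X]mxE [X in _ - X]mxE floor_mx_close.
  by rewrite mulr1 -mulrA ler_wpM2l.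
have cl : 0 < N.+1%:R - m%:R * K.
  have : 0 < X N by apply: lt_le_trans X_ge.
  by rewrite /X pmulr_lgt0 // pmulr_rgt0.
have : (N.+1%:R - m%:R * K) * l <= 2 * (T + m)%:R.
  apply: le_trans le1; apply: le_trans le2.
  by rewrite -mulrBl ler_pM2l.
have -> : (N.+1%:R - m%:R * K) * l = 2 * X N by rewrite /X; field.
rewrite ler_pM2l // leNgt => /negP; apply; apply: lt_le_trans trX.
by rewrite ltr_nat addnS.
Unshelve. all: by end_near.
Qed.

(** The conditions [v_i <= r] and [- sum v_i <= r] define a simplex: in terms of [u_i = r - v_i] it
    is [u >= 0], [sum u_i <= (m + 1) r], of volume [((m + 1) r)^m / m!]. If this is below the
    covolume, its lattice translates leave a hole. Read on vectors with [m + 1] coordinates and sum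
    zero, the conclusion is that some coordinate exceeds [r]. *)
Lemma lattice_covering m (A : 'M[R]_m) (r : R) : 0 <= r ->
  (m.+1%:R * r) ^+ m < m`!%:R * `|\det A| ->
  exists a : 'rV[R]_m, forall k : 'rV[int]_m,
    (exists i, r < (a + map_mx intr k *m A) 0 i) \/
    r < - \sum_i (a + map_mx intr k *m A) 0 i.
Proof.
move=> r0 lt_det.
have detA : \det A != 0.
  apply: contraTneq lt_det => ->.
  by rewrite normr0 mulr0 -leNgt exprn_ge0 // mulr_ge0.
have Au : A \in unitmx by rewrite unitmxE unitfE.
have [K K0 KA] := l1_le_mulmx Au.
pose B N : 'M[R]_m := map_mx intr (floor_mx N.+1 A).
(* On the simplex [|v_i| <= m r], so its points have norm at most [m (m r)]; [K] passes to the
   coefficients and the outer [m] to the rounding error. The simplex is enlarged by this amount,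
   which does not depend on [N]. *)
pose c : R := m%:R * (K * (m%:R * (m%:R * r))).
pose X N : R := m.+1%:R * (N.+1%:R * r + c).
have c0 : 0 <= c by rewrite !mulr_ge0.
have X0 N : 0 <= X N by rewrite mulr_ge0 // addr_ge0 // mulr_ge0.
have cX : m`!%:R * `|\det (B N) / N.+1%:R ^+ m| - ((m%:R + X N) / N.+1%:R) ^+ m
    @[N --> \oo] --> m`!%:R * `|\det A| - (m.+1%:R * r) ^+ m.
  apply: cvgB.
    apply: cvgM; first exact: cvg_cst.
    by apply: cvg_norm; exact: cvg_det_floor_mx.
  apply: (@continuous_cvg _ _ _ _ _ _ (fun x : R => x ^+ m)).
    exact: exprn_continuous.
  have -> : (fun N => (m%:R + X N) / N.+1%:R) =
            (fun N => m.+1%:R * r + (m%:R + m.+1%:R * c) * harmonic N).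
    apply/funext => N; rewrite /X /harmonic /=.
    have : N.+1%:R != 0 :> R by rewrite pnatr_eq0.
    move: N.+1%:R m.+1%:R m%:R => a d e a0.
    by field.
  rewrite -[X in _ --> X]addr0; apply: cvgD; first exact: cvg_cst.
  rewrite -(mulr0 (m%:R + m.+1%:R * c)).
  by apply: cvgM; [exact: cvg_cst | exact: cvg_harmonic].
have [N [big detB]] : exists N,
    0 < m`!%:R * `|\det (B N) / N.+1%:R ^+ m| - ((m%:R + X N) / N.+1%:R) ^+ m /\
    0 < `|\det (B N) / N.+1%:R ^+ m|.
  apply: (@filter_ex _ \oo); near=> N; split; near: N.
    by apply: (cvgr_gt _ cX); rewrite subr_gt0.
  apply: (cvgr_gt `|\det A|); last by rewrite normr_gt0.
  by apply: cvg_norm; exact: cvg_det_floor_mx.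
have {}big : (m%:R + X N) ^+ m < m`!%:R * `|\det (B N)|.
  move: big; rewrite subr_gt0 expr_div_n normrM normfV [`|_ ^+ _|]ger0_norm ?exprn_ge0 //.
  by rewrite mulrA ltr_pM2r // invr_gt0 exprn_gt0.
have Bu : B N \in unitmx.
  by move: detB; rewrite unitmxE unitfE normr_gt0 mulf_eq0 negb_or => /andP[].
pose T := Num.truncn (X N); pose s0 := Num.truncn (N.+1%:R * r + c).
have /andP[leT ltT] := truncn_itv (X0 N).
have s00 : 0 <= N.+1%:R * r + c by rewrite addr_ge0 // mulr_ge0.
have /andP[les0 lts0] := truncn_itv s00.
(* The integer points of the enlarged simplex, counted down from the corner with all coordinates
   [s0]. *)
pose s (t : simplex m T) : 'rV[int]_m := \row_j (s0%:Z - (tnth (val t) j)%:Z).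
have /(int_mx_missed_coset s)[z zP] :
    (#|{: simplex m T}| < `|\det (floor_mx N.+1 A)|)%N.
  rewrite card_simplex -(ltr_nat R) -det_map_int -(ltr_pM2l (_ : 0 < m`!%:R)) ?ltr0n ?fact_gt0 //.
  apply: le_lt_trans big; rewrite -natrM mulnC.
  apply: le_trans (_ : (m + T)%:R ^+ m <= _).
    by rewrite -natrX ler_nat ffact_simplex_le.
  have mX : 0 <= m%:R + X N by rewrite addr_ge0.
  by rewrite lerXn2r ?nnegrE // natrD lerD2l.
pose zR : 'rV[R]_m := map_mx intr z.
(* The missed coset [z], rewritten in coefficients and transported to the lattice of [A]. If a
   translate fell into the simplex, the matching [z + k B] would be within [c] of its multiple by
   [N], hence one of the points [s t]. *)
exists (zR *m invmx (B N) *m A) => k.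
pose kap : 'rV[R]_m := zR *m invmx (B N) + map_mx intr k.
have Dv : zR *m invmx (B N) *m A + map_mx intr k *m A = kap *m A by rewrite mulmxDl.
rewrite Dv; set v := kap *m A.
have [[i lt_i]|le_r] := pselect (exists i, r < v 0 i); first by left; exists i.
have {le_r} le_r i : v 0 i <= r by rewrite leNgt; apply/negP => lt_i; apply: le_r; exists i.
right; rewrite ltNge; apply/negP => le_sum.
pose y := z + k *m floor_mx N.+1 A.
have Dy : map_mx intr y = kap *m B N.
  by rewrite mulmxDl mulmxKV // map_mxD map_mxM.
have abs_v i : `|v 0 i| <= m%:R * r.
  have m0 : (0 < m)%N by apply: leq_ltn_trans (ltn_ord i).
  rewrite ler_norml; apply/andP; split; last first.
    by apply: le_trans (le_r i) _; rewrite ler_peMl // ler1n.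
  rewrite lerNl; apply: le_trans (_ : r + \sum_(j | j != i) v 0 j <= _).
    by move: le_sum; rewrite (bigD1 i) //= opprD => ?; rewrite -lerBlDr.
  apply: le_trans (_ : r + \sum_(j | j != i) r <= _).
    by rewrite lerD2l ler_sum.
  have := cardC1 i; rewrite sumr_const card_ord -/(predC1 _) => ->.
  by rewrite -mulrS prednK ?mulr_natl.
have l1v : l1 v <= m%:R * (m%:R * r).
  apply: le_trans (ler_sum _ (fun j _ => abs_v j)) _.
  by rewrite sumr_const card_ord -[leLHS]mulr_natl.
have l1yv : l1 (map_mx intr y - N.+1%:R *: v) <= c.
  have -> : map_mx intr y - N.+1%:R *: v = kap *m (B N - N.+1%:R *: A).
    by rewrite Dy mulmxBr scalemxAr.
  apply: le_trans (l1_mulmx (c := 1) _ _) _ => [q1 q2|].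
    by rewrite mxE [X in _ + X]mxE [X in _ - X]mxE floor_mx_close.
  rewrite mulr1 ler_wpM2l //; apply: le_trans (KA kap) _.
  by rewrite ler_wpM2l.
have yvE (y0 : 'rV[int]_m) (v0 : 'rV[R]_m) j :
    (map_mx intr y0 - N.+1%:R *: v0) 0 j = (y0 0 j)%:~R - N.+1%:R * v0 0 j.
  by rewrite !mxE.
have y_le j : (y 0 j)%:~R <= N.+1%:R * r + c.
  have := le_trans (le_l1 _ j) l1yv; rewrite yvE ler_norml => /andP[_ +].
  rewrite lerBlDr => /le_trans; apply; rewrite [leRHS]addrC lerD2l.
  by apply: ler_wpM2l => //; exact: le_r.
have y_sum : - (N.+1%:R * r + c) <= \sum_j (y 0 j)%:~R.
  have : `|\sum_j ((y 0 j)%:~R - N.+1%:R * v 0 j)| <= c.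
    apply: le_trans l1yv; apply: le_trans (ler_norm_sum _ _ _) _.
    by rewrite /l1 ler_sum // => j _; rewrite yvE.
  rewrite ler_norml => /andP[+ _]; rewrite sumrB -mulr_sumr lerBrDr => /(le_trans _); apply.
  by rewrite opprD addrC lerD2l -mulrN ler_wpM2l // lerNl.
have y_s0 j : y 0 j <= s0%:Z.
  rewrite -ltzD1 -(ltr_int R) (le_lt_trans (y_le j)) //.
  by rewrite intrD natr1.
pose w j := absz (s0%:Z - y 0 j)%R.
have Dw j : (w j)%:Z = s0%:Z - y 0 j by rewrite /w gez0_abs // subr_ge0.
have sum_w : (\sum_j w j <= T)%N.
  rewrite truncn_ge_nat // natr_sum.
  have wE j : (w j)%:R = s0%:R - (y 0 j)%:~R :> R by rewrite [LHS]pmulrn Dw intrD rmorphN.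
  under eq_bigr => j _ do rewrite wE.
  rewrite sumrB sumr_const card_ord /X -natr1 mulrDl mul1r.
  apply: lerD; last by rewrite lerNl.
  by rewrite -[leLHS]mulr_natl ler_wpM2l.
have w_le j : (w j < T.+1)%N.
  by rewrite ltnS (leq_trans _ sum_w) // (bigD1 j) //= leq_addr.
pose t : m.-tuple 'I_T.+1 := [tuple Ordinal (w_le j) | j < m].
have tP : (\sum_(i <- t) i <= T)%N.
  by rewrite big_tuple; under eq_bigr do rewrite tnth_mktuple.
have /eqP := zP (exist _ t tP) k; apply.
by apply/rowP => j; rewrite -/y [RHS]mxE /= tnth_mktuple /= Dw opprB addrCA subrr addr0.
Unshelve. all: by end_near.
Qed.

End PackingCovering.

(** * Hermite reduction *)

Section Hermite.
Variable R : realType.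

Definition qform n (G : 'M[R]_n) (x : 'rV[R]_n) : R := (x *m G *m x^T) 0 0.

Lemma qform_mulmx m n (G : 'M[R]_n) (P : 'M[R]_(m, n)) x :
  qform (P *m G *m P^T) x = qform G (x *m P).
Proof. by rewrite /qform trmx_mul !mulmxA. Qed.

Lemma qformZ n (G : 'M[R]_n) (k : R) x : qform G (k *: x) = k ^+ 2 * qform G x.
Proof. by rewrite /qform linearZ /= -scalemxAr -!scalemxAl !mxE mulrA -expr2. Qed.

Lemma qform_delta n (G : 'M[R]_n) i : qform G (delta_mx 0 i) = G i i.
Proof. by rewrite /qform -rowE trmx_delta -colE !mxE. Qed.

(* Completing the square with respect to the first variable. *)
Lemma qform_schur n (a : R) (b : 'rV[R]_n) (D : 'M[R]_n) (x0 : R) (y : 'rV[R]_n) :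
  a != 0 ->
  qform (block_mx a%:M b b^T D) (row_mx x0%:M y) =
  a * (x0 + (y *m b^T) 0 0 / a) ^+ 2 + qform (D - a^-1 *: (b^T *m b)) y.
Proof.
move=> a0; set be := (y *m b^T) 0 0.
have E : y *m b^T = be%:M by rewrite [LHS]mx11_scalar.
have E' : b *m y^T = be%:M by rewrite -[LHS]trmxK trmx_mul trmxK E tr_scalar_mx.
rewrite /qform mul_row_block tr_row_mx mul_row_col tr_scalar_mx.
rewrite mulmxBr -scalemxAr mulmxBl -scalemxAl !mulmxA E mulmxDl -!mulmxA.
rewrite !mul_scalar_mx mulmxDl -scalemxAl E' mulmxA.
move: (y *m D *m y^T) => M; clearbody be.
rewrite !mxE /= !mulr1n.
by field.
Qed.

Lemma det_schur n (a : R) (b : 'rV[R]_n) (D : 'M[R]_n) : a != 0 ->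
  \det (block_mx a%:M b b^T D : 'M[R]_(1 + n)) = a * \det (D - a^-1 *: (b^T *m b)).
Proof.
move=> a0; pose P : 'M[R]_(1 + n) := block_mx 1%:M 0 (- (a^-1 *: b^T)) 1%:M.
have <- : \det (P *m block_mx a%:M b b^T D) = \det (block_mx a%:M b b^T D).
  by rewrite det_mulmx det_lblock !det1 !mul1r.
rewrite mulmx_block !mul1mx !mul0mx !addr0 mulNmx mul_mx_scalar scalerA divff //.
by rewrite scale1r addNr det_ublock det_scalar1 mulNmx -scalemxAl addrC.
Qed.

(** Smith normal form of a one-row matrix, which has a single elementary divisor. *)
Lemma int_row_completion n (x : 'rV[int]_n.+1) : x != 0 ->
  exists (U : 'M[int]_n.+1) (d : int),
    [/\ U \in unitmx, d != 0 & x = d *: row 0 U].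
Proof.
move=> x0; have [L _ [U Uu [e _ Dx]]] := int_Smith_normal_form x.
have Dxd : x = (L 0 0 * e`_0) *: row 0 U.
  rewrite {1}Dx [L]mx11_scalar !mul_scalar_mx -scalerA -scalemxAl rowE; congr (_ *: _).
    by rewrite mxE.
  rewrite [in RHS]scalemxAl; congr (_ *m _); apply/rowP => j; rewrite !mxE !eqxx /=.
  by rewrite eq_sym -val_eqE /=; case: (_ == _); rewrite ?mulr1 ?mulr0 ?mulr1n.
exists U, (L 0 0 * e`_0); split=> //.
by apply: contra_neq x0 => d0; rewrite Dxd d0 scale0r.
Qed.

(** Hermite's induction splits off a primitive vector of nearly minimal value and projects along it.
    Only near-minimality is available, whence a constant strictly above 4/3. *)
Lemma hermite_bound (c : R) n (G : 'M[R]_n) (l : R) :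
  4 / 3 < c -> G^T = G -> 0 < l ->
  (forall x : 'rV[int]_n, x != 0 -> l <= qform G (map_mx intr x)) ->
  l ^+ n <= c ^+ 'C(n, 2) * \det G.
Proof.
move=> c43; elim: n G l => [|n IHn] G l symG l0 lG.
  by rewrite det_mx00 mulr1 !expr0.
have c0 : 0 < c by apply: lt_trans c43; rewrite divr_gt0.
pose S : set R := [set y | exists2 x : 'rV[int]_n.+1, x != 0 & y = qform G (map_mx intr x)].
have lbS : lbound S l by move=> _ [x x0 ->]; exact: lG.
have infS : has_inf S.
  split; last by exists l.
  exists (qform G (map_mx intr (delta_mx 0 0))), (delta_mx 0 0) => //.
  by apply/eqP => /matrixP/(_ 0 0); rewrite !mxE.
pose mu := inf S.
have lmu : l <= mu by apply: lb_le_inf => //; exact: infS.1.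
have mu0 : 0 < mu by apply: lt_le_trans lmu.
have muG x : x != 0 -> mu <= qform G (map_mx intr x).
  by move=> x0; apply: ge_inf; [exact: infS.2 | exists x].
(* The room left by [c > 4/3]: the square completed with offset at most 1/2 gives [mu <= a / 4 + q],
   so [a < 4 (1 - 1/c) mu] suffices for [q >= mu / c]. *)
have c1 : 1 < 4 * (1 - c^-1).
  have : c^-1 < 3 / 4 by rewrite -[3 / 4]invf_div ltf_pV2 ?posrE ?divr_gt0.
  by lra.
have [x [x0 qx]] : exists x : 'rV[int]_n.+1,
    x != 0 /\ qform G (map_mx intr x) < mu * (4 * (1 - c^-1)).
  have e0 : 0 < mu * (4 * (1 - c^-1)) - mu by rewrite subr_gt0 ltr_pMr.
  have [_ [x x0 ->]] := inf_adherent e0 infS.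
  by rewrite addrC subrK => qx; exists x.
have [U [d [Uu d0 Dx]]] := int_row_completion x0.
pose UR : 'M[R]_n.+1 := map_mx intr U.
have detU : (\det UR) ^+ 2 = 1.
  rewrite /UR det_map_mx -rmorphXn /=.
  by move: Uu; rewrite unitmxE => /orP[]/eqP->; rewrite ?sqrrN expr1n.
pose H : 'M[R]_(1 + n) := UR *m G *m UR^T.
have symH : H^T = H by rewrite /H !trmx_mul trmxK symG mulmxA.
have detH : \det H = \det G.
  by rewrite /H !det_mulmx det_tr mulrAC -expr2 detU mul1r.
have muH (z : 'rV[int]_(1 + n)) : z != 0 -> mu <= qform H (map_mx intr z).
  move=> z0; rewrite /H qform_mulmx -map_mxM muG //.
  by apply: contra_neq z0 => zU; rewrite -(mulmxK Uu z) zU mul0mx.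
have delta_int : delta_mx 0 0 = map_mx intr (delta_mx 0 0) :> 'rV[R]_(1 + n).
  by rewrite map_delta_mx.
pose a := H 0 0.
have Da : a = qform G (map_mx intr (row 0 U)).
  by rewrite /a -qform_delta /H qform_mulmx delta_int -map_mxM -rowE.
have mua : mu <= a.
  rewrite /a -qform_delta delta_int muH //.
  by apply/eqP => /matrixP/(_ 0 0); rewrite !mxE.
have a0 : 0 < a by apply: lt_le_trans mua.
(* Dividing the vector by [d] divides its value by [d^2 >= 1], so the primitive vector is
   near-minimal too. *)
have a_lt : a < mu * (4 * (1 - c^-1)).
  apply: le_lt_trans qx; rewrite Dx map_mxZ qformZ -Da ler_peMl ?(ltW a0) //.
  rewrite -rmorphXn /= ler1z -gtz0_ge1.
  by rewrite exprn_even_gt0.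
clearbody H; pose b : 'rV[R]_n := ursubmx H; pose D : 'M[R]_n := drsubmx H.
have DH : H = block_mx a%:M b b^T D.
  rewrite -[LHS]submxK; congr block_mx.
    by rewrite [LHS]mx11_scalar !mxE; congr (H _ _)%:M; apply: val_inj.
  by rewrite /b trmx_ursub symH.
pose G' : 'M[R]_n := D - a^-1 *: (b^T *m b).
have symD : D^T = D by rewrite /D trmx_drsub symH.
have symG' : G'^T = G'.
  by rewrite /G' linearB /= linearZ /= trmx_mul trmxK symD.
have muG' (y : 'rV[int]_n) : y != 0 -> mu / c <= qform G' (map_mx intr y).
  move=> y0; pose be := (map_mx intr y *m b^T) 0 0 / a.
  (* Minus a nearest integer to [be], so that [|k + be| <= 1/2]. *)
  pose k : int := - Num.floor (be + 2^-1).
  have ky0 : row_mx k%:M y != 0.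
    by apply: contra_neq y0 => /eqP; rewrite row_mx_eq0 => /andP[_ /eqP].
  have := muH _ ky0; rewrite DH map_row_mx map_scalar_mx qform_schur ?gt_eqF //= -/G' -/be.
  have : (k%:~R + be) ^+ 2 <= 4^-1.
    have -> : 4^-1 = 2^-1 ^+ 2 :> R by field.
    rewrite -[leLHS]real_normK ?num_real // lerXn2r ?nnegrE ?invr_ge0 //.
    rewrite ler_norml /k rmorphN /=.
    have := floor_le (be + 2^-1); have := floorD1_gt (be + 2^-1); rewrite intrD.
    move: (_%:~R) => f h1 h2; apply/andP; split; lra.
  rewrite -(ler_pM2l a0) => h1 h2.
  have -> : mu / c = mu - mu * (4 * (1 - c^-1)) / 4 by field; rewrite gt_eqF.
  lra.
have := IHn _ _ symG' (divr_gt0 mu0 c0) muG'.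
rewrite -detH DH det_schur ?gt_eqF // -/G' => ind.
apply: le_trans (_ : mu ^+ n.+1 <= _).
  by rewrite lerXn2r ?nnegrE // ltW.
have -> : mu ^+ n.+1 = c ^+ n * (mu * (mu / c) ^+ n).
  by rewrite expr_div_n exprS; field; rewrite expf_neq0 ?gt_eqF.
rewrite binS bin1 exprD -mulrA [leRHS]mulrCA.
rewrite ler_wpM2l ?exprn_ge0 ?(ltW c0) //.
apply: le_trans (_ : mu * (c ^+ 'C(n, 2) * \det G') <= _).
  by rewrite ler_wpM2l ?(ltW mu0).
rewrite mulrCA ler_wpM2l ?exprn_ge0 ?(ltW c0) // ler_wpM2r //.
have : 0 < c ^+ 'C(n, 2) * \det G' by apply: lt_le_trans ind; rewrite exprn_gt0 ?divr_gt0.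
by rewrite pmulr_rgt0 ?exprn_gt0 // => /ltW.
Qed.

End Hermite.

(** * Embeddings and integral bases *)

Section Embeddings.
Variables (R : realType) (L : fieldExtType rat) (n : nat).
Variable sigma : 'I_n -> {rmorphism L -> R}.

Lemma rmorph_scale_rat (f : {rmorphism L -> R}) c x : f (c *: x) = ratr c * f x.
Proof.
have := fmorph_eq_rat (f \o in_alg L) c => /= <-.
by rewrite -rmorphM /= mulr_algl.
Qed.

(** Dedekind's argument, by induction on the number of nonzero coefficients: substituting [x z] for
    [z] and subtracting [sigma k0 x] times the relation kills the coefficient at [k0] but not at
    [k1], when [x] separates the two embeddings. *)
Lemma embeddings_independent : real_embeddings sigma -> forall y : 'I_n -> R,
  (forall x, \sum_k y k * sigma k x = 0) -> forall k, y k = 0.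
Proof.
move=> sigma_inj y; have [N] := ubnP #|[pred k | y k != 0]|.
elim: N y => // N IHN y; rewrite ltnS => leN y0 k0; apply/eqP/negPn/negP => yk0.
have [k1 [yk1 k10]] : exists k1, y k1 != 0 /\ k1 != k0.
  apply: contrapT => no_k1; have := y0 1.
  rewrite (bigD1 k0) //= big1 ?addr0 ?rmorph1 ?mulr1 => [|k kk0].
    by move/eqP; rewrite (negPf yk0).
  have [->|yk] := eqVneq (y k) 0; first by rewrite mul0r.
  by case: no_k1; exists k.
have [x neq_x] : exists x, sigma k1 x != sigma k0 x.
  apply: contrapT => no_x; move/eqP: k10; apply; apply: sigma_inj => x.
  by apply/eqP/negPn/negP => neq_x; apply: no_x; exists x.
suff /eqP : y k1 * (sigma k1 x - sigma k0 x) = 0.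
  by rewrite mulf_eq0 (negPf yk1) subr_eq0 (negPf neq_x).
apply: (IHN (fun k => y k * (sigma k x - sigma k0 x))); last first.
  move=> z; rewrite (eq_bigr (fun k => y k * sigma k (x * z) - sigma k0 x * (y k * sigma k z))).
    by rewrite sumrB -mulr_sumr !y0 mulr0 subrr.
  by move=> k _; rewrite rmorphM; ring.
apply: leq_trans leN; apply: proper_card; apply/properP; split.
  apply/fintype.subsetP => k; rewrite !inE; apply: contra => /eqP->.
  by rewrite mul0r.
by exists k0; rewrite !inE // subrr mulr0 eqxx.
Qed.

Definition emb_mx (e : 'I_n -> L) : 'M[R]_n := \matrix_(i, k) sigma k (e i).

Lemma emb_mx_unit (e : 'I_n -> L) : real_embeddings sigma ->
  (forall x, exists c : 'I_n -> rat, x = \sum_i c i *: e i) ->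
  emb_mx e \in unitmx.
Proof.
move=> sigma_inj spane; rewrite -unitmx_tr unitmxE unitfE; apply/negP => /det0P[v v0 vE].
case/eqP: v0; apply/rowP => k; rewrite [RHS]mxE.
apply: embeddings_independent (v 0) _ k => // x; have [c ->] := spane x.
under eq_bigr => k _ do rewrite rmorph_sum mulr_sumr.
rewrite exchange_big big1 // => i _.
have /rowP/(_ i) := vE; rewrite !mxE => vEi.
under eq_bigr => k _ do rewrite rmorph_scale_rat mulrCA.
rewrite -mulr_sumr; under eq_bigr => k _ do [move: vEi => _].
rewrite (eq_bigr (fun k => v 0 k * (emb_mx e)^T k i)) ?vEi ?mulr0 // => k _.
by rewrite !mxE.
Qed.

Section Multiplication.
Variables (e : 'I_n -> L) (M : 'M[R]_n) (x : L).
Hypothesis Eu : emb_mx e \in unitmx.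
Hypothesis ME : M *m emb_mx e = emb_mx e *m diag_mx (\row_k sigma k x).

(** The embedding matrix diagonalises multiplication by [x], with the conjugates as eigenvalues.
    This serves a rational basis for the trace and an integral basis for the norm. *)
Lemma mult_mx_conj : M = emb_mx e *m diag_mx (\row_k sigma k x) *m invmx (emb_mx e).
Proof. by rewrite -ME mulmxK. Qed.

Lemma trace_mult_mx : \tr M = \sum_k sigma k x.
Proof.
rewrite mult_mx_conj mxtrace_mulC mulmxA mulVmx // mul1mx mxtrace_diag.
by apply: eq_bigr => k _; rewrite mxE.
Qed.

Lemma det_mult_mx : \det M = \prod_k sigma k x.
Proof.
rewrite mult_mx_conj !det_mulmx mulrAC -det_mulmx mulmxV // det1 mul1r det_diag.
by apply: eq_bigr => k _; rewrite mxE.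
Qed.

End Multiplication.

Lemma mult_mx_emb (e : 'I_n -> L) (M : 'M[R]_n) x :
  (forall i k, sigma k (x * e i) = \sum_j M i j * sigma k (e j)) ->
  M *m emb_mx e = emb_mx e *m diag_mx (\row_k sigma k x).
Proof.
move=> Mx; apply/matrixP => i k; rewrite mul_mx_diag !mxE mulrC -rmorphM Mx.
by apply: eq_bigr => j _; rewrite mxE.
Qed.

Lemma is_integralP (x : L) : is_integral x <-> integralOver (intr : int -> L) x.
Proof. by split=> [[p []]|[p]]; exists p. Qed.

Lemma is_integralM (x y : L) : is_integral x -> is_integral y -> is_integral (x * y).
Proof. by rewrite !is_integralP; apply: integral_mul. Qed.

Lemma is_integralB (x y : L) : is_integral x -> is_integral y -> is_integral (x - y).
Proof. by rewrite !is_integralP; apply: integral_sub. Qed.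

Lemma is_integral_int (z : int) : is_integral (z%:~R : L).
Proof. by rewrite is_integralP; apply: integral_id. Qed.

Lemma is_integral_sum (I : finType) (F : I -> L) :
  (forall i, is_integral (F i)) -> is_integral (\sum_i F i).
Proof.
move=> intF; elim/big_ind: _ => // [|x y]; first exact: (is_integral_int 0).
by rewrite !is_integralP; apply: integral_add.
Qed.

Lemma intr_ext_eq0 (z : int) : (z%:~R == 0 :> L) = (z == 0).
Proof. by rewrite -(rmorph_int (in_alg L)) fmorph_eq0 intr_eq0. Qed.

(** If [l] is the leading coefficient of an integer polynomial [r] of degree [d + 1] killing [x],
    then [l x] is a root of the monic polynomial with lower coefficients [r_i l^(d - i)]. Hence an
    integral basis spans [L] over the rationals. *)
Lemma integral_multiple (x : L) : exists2 d : int, d != 0 & is_integral (d%:~R * x).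
Proof.
have /polyOver1P[p Dp] := minPolyOver 1 x.
have [r [a a0 Dr]] := rat_poly_scale p.
have p0 : p != 0.
  by rewrite -(map_poly_eq0 (in_alg L)) -Dp monic_neq0 ?monic_minPoly.
have rx : root (map_poly intr r) x.
  have := root_minPoly 1 x; rewrite Dp Dr linearZ /= rootZ; last first.
    by rewrite scaler_eq0 oner_eq0 orbF invr_eq0 intr_eq0.
  rewrite -map_poly_comp; congr (root _ x); apply: eq_map_poly => z /=.
  by rewrite -in_algE rmorph_int.
have r0 : r != 0 by apply: contra_neq p0 => r0; rewrite Dr r0 map_poly0 scaler0.
case Ds : (size r) => [|[|d]]; first by move/eqP: Ds; rewrite size_poly_eq0 (negPf r0).
  have Dc := size1_polyC (eq_leq Ds); rewrite Dc map_polyC /= rootC in rx.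
  by move: rx; rewrite intr_ext_eq0 -polyC_eq0 -Dc (negPf r0).
pose l := lead_coef r; have l0 : l != 0 by rewrite lead_coef_eq0.
exists l => //.
pose c i : int := if i == d.+1 then 1 else r`_i * l ^+ (d - i).
exists (\poly_(i < d.+2) c i); split.
  by rewrite monicE lead_coef_poly //= /c eqxx ?oner_eq0.
have -> : map_poly (intr : int -> L) (\poly_(i < d.+2) c i) = \poly_(i < d.+2) (c i)%:~R.
  by apply/polyP => i; rewrite coef_map !coef_poly /=; case: ifP.
rewrite /root horner_poly.
have -> : \sum_(i < d.+2) (c i)%:~R * (l%:~R * x) ^+ i =
          l%:~R ^+ d * (map_poly intr r).[x].
  rewrite (horner_coef_wide _ (_ : (_ <= d.+2)%N)); last by rewrite -Ds size_poly.
  rewrite mulr_sumr; apply: eq_bigr => i _.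
  rewrite coef_map /= exprMn /c; case: eqP => [->|/eqP id].
    have -> : r`_d.+1 = l by rewrite /l /lead_coef Ds.
    by rewrite mul1r [l%:~R ^+ d.+1]exprSr mulrA.
  have le_id : (i <= d)%N by have := ltn_ord i; rewrite ltnS leq_eqVlt (negPf id).
  have -> : l%:~R ^+ d = l%:~R ^+ (d - i) * l%:~R ^+ i :> L by rewrite -exprD subnK.
  by rewrite rmorphM rmorphXn /=; ring.
by move/rootP: rx => ->; rewrite mulr0.
Qed.

Section IntegralBasis.
Variable b : 'I_n -> L.
Hypotheses (sigma_inj : real_embeddings sigma) (hb : integral_basis b).

Lemma integral_basis_span x : exists c : 'I_n -> rat, x = \sum_i c i *: b i.
Proof.
have [d d0 /hb.2[c Dc]] := integral_multiple x.
exists (fun i => (c i)%:~R / d%:~R).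
have d0L : d%:~R != 0 :> L by rewrite intr_ext_eq0.
rewrite -[x](mulKf d0L) Dc mulr_sumr; apply: eq_bigr => i _.
by rewrite -[RHS]mulr_algl -in_algE rmorphM fmorphV !rmorph_int mulrA [_^-1 * _]mulrC.
Qed.

Lemma integral_basis_unit : emb_mx b \in unitmx.
Proof. exact: emb_mx_unit integral_basis_span. Qed.

Lemma integral_of_coordinates (x : 'rV[int]_n) : x != 0 -> exists y : L,
  [/\ is_integral y, y != 0 &
      forall k, (map_mx intr x *m emb_mx b) 0 k = sigma k y].
Proof.
move=> x0; pose y := \sum_i (x 0 i)%:~R * b i.
have Dy k : (map_mx intr x *m emb_mx b) 0 k = sigma k y.
  rewrite mxE rmorph_sum; apply: eq_bigr => i _.
  by rewrite !mxE rmorphM rmorph_int.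
exists y; split=> //.
  by apply: is_integral_sum => i; apply: is_integralM; [exact: is_integral_int | exact: hb.1].
apply: contra_neq x0 => y0.
have xE : map_mx intr x *m emb_mx b = 0.
  by apply/rowP => j; rewrite Dy y0 rmorph0 mxE.
have /rowP x0 : map_mx intr x = 0 :> 'rV[R]_n.
  by rewrite -[LHS](mulmxK integral_basis_unit) xE mul0mx.
apply/rowP => i; have := x0 i; rewrite !mxE => /eqP.
by rewrite intr_eq0 => /eqP.
Qed.

(** The product of the conjugates is the determinant of multiplication by [x] in the integral basis,
    an integer matrix. *)
Lemma integral_emb_prod x : is_integral x ->
  exists N : int, \prod_k sigma k x = N%:~R.
Proof.
move=> xI.
have /choice[c Dc] : forall i, exists c : 'I_n -> int, x * b i = \sum_j (c j)%:~R * b j.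
  by move=> i; apply: hb.2; apply: is_integralM => //; exact: hb.1.
pose M : 'M[int]_n := \matrix_(i, j) c i j.
exists (\det M); rewrite -(det_mult_mx (M := map_mx intr M) integral_basis_unit).
  by rewrite det_map_mx.
apply: mult_mx_emb => i k; rewrite Dc rmorph_sum; apply: eq_bigr => j _.
by rewrite rmorphM rmorph_int !mxE.
Qed.

Lemma integral_emb_prod_ge1 x : is_integral x -> x != 0 -> 1 <= `|\prod_k sigma k x|.
Proof.
move=> xI x0; have [N DN] := integral_emb_prod xI.
have : \prod_k sigma k x != 0 by apply/prodf_neq0 => k _; rewrite fmorph_eq0.
by rewrite DN intr_eq0 -normr_gt0 -intr_norm ler1z gtz0_ge1.
Qed.

Lemma unit_emb_prod u : is_unitK u -> `|\prod_k sigma k u| = 1.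
Proof.
case=> u0 [uI uVI]; apply/eqP; rewrite eq_le integral_emb_prod_ge1 // andbT.
have := integral_emb_prod_ge1 uVI; rewrite invr_eq0 => /(_ u0).
under eq_bigr do rewrite fmorphV.
by rewrite prodfV normfV invf_ge1 ?normr_gt0 //; apply/prodf_neq0 => k _; rewrite fmorph_eq0.
Qed.

End IntegralBasis.
End Embeddings.

Lemma traceK_emb (R : realType) (L : fieldExtType rat) (n : nat)
    (sigma : 'I_n -> {rmorphism L -> R}) (x : L) :
  \dim {:L} = n -> real_embeddings sigma ->
  ratr (traceK x) = \sum_k sigma k x.
Proof.
move=> Dn; case: n / Dn in sigma * => sigma_inj.
set e := vbasis {:L}; have eB : basis_of {:L} e := vbasisP _.
pose ei (i : 'I_(\dim {:L})) := e`_i.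
have Eu : emb_mx sigma ei \in unitmx.
  apply: emb_mx_unit => // y; exists (fun i => coord e i y).
  by rewrite {1}(coord_basis eB (memvf y)).
rewrite /traceK -/e; set M := passmx.mxof e e (amull x).
have -> : ratr (\tr M) = \tr (map_mx ratr M : 'M[R]_(\dim {:L})).
  by rewrite /mxtrace rmorph_sum; apply: eq_bigr => i _; rewrite [RHS]mxE.
rewrite (trace_mult_mx (x := x) Eu) //; apply: mult_mx_emb => i k.
have -> : x * ei i = passmx.vecof e (delta_mx 0 i *m M).
  by rewrite -passmx.hom_vecof // lfunE /= -(passmx.rVofE eB) passmx.rVofK.
rewrite /passmx.vecof rmorph_sum; apply: eq_bigr => j _.
by rewrite rmorph_scale_rat -rowE [in RHS]mxE [in LHS]mxE.
Qed.

Lemma disc_emb (R : realType) (L : fieldExtType rat) (n : nat)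
    (sigma : 'I_n -> {rmorphism L -> R}) (b : 'I_n -> L) :
  \dim {:L} = n -> real_embeddings sigma ->
  ratr (disc_of_basis b) = (\det (emb_mx sigma b)) ^+ 2.
Proof.
move=> Dn sigma_inj; rewrite /disc_of_basis -det_map_mx expr2.
rewrite -[X in _ * X]det_tr -det_mulmx; congr (\det _); apply/matrixP => i j.
rewrite !mxE /= (traceK_emb _ Dn sigma_inj); apply: eq_bigr => k _.
by rewrite !mxE rmorphM.
Qed.

(** By the inequality of the means and [|N(y)| >= 1], the conjugates of a nonzero integer have
    absolute values of sum at least [n], so the packing bound applies with [l = n]. *)
Lemma minkowski_disc_bound (R : realType) (L : fieldExtType rat) (n : nat)
    (sigma : 'I_n -> {rmorphism L -> R}) (b : 'I_n -> L) :
  \dim {:L} = n -> real_embeddings sigma -> integral_basis b ->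
  (n%:R ^+ n) ^+ 2 <= n`!%:R ^+ 2 * ratr (disc_of_basis b) :> R.
Proof.
move=> Dn sigma_inj hb.
have Eu := integral_basis_unit sigma_inj hb.
rewrite (disc_emb b Dn sigma_inj) -exprMn -[X in _ <= X]real_normK ?num_real //.
rewrite lerXn2r ?nnegrE ?exprn_ge0 // normrM normr_nat.
apply: lattice_packing => [||x x0] //; first by rewrite -unitfE -unitmxE.
have [y [yI y0 Dy]] := integral_of_coordinates sigma_inj hb x0.
rewrite /l1; under eq_bigr do rewrite Dy.
case: (posnP n) => [n0|n0]; first by rewrite [n in n%:R]n0 sumr_ge0.
rewrite -(@ler_pXn2r _ n) ?nnegrE ?sumr_ge0 //.
have [AGM _] := leif_AGM_scaled (I := 'I_n) (A := predT) (E := fun k => `|sigma k y|)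
  (fun k _ => mulrn_wge0 _ (normr_ge0 _)).
rewrite card_ord in AGM; apply: le_trans AGM.
under eq_bigr do rewrite -mulr_natl.
rewrite big_split /= prodr_const card_ord ler_peMr ?exprn_ge0 //.
by rewrite -normr_prod (integral_emb_prod_ge1 sigma_inj hb).
Qed.

(** * Unit reducible fields *)

Lemma le_of_le_expR (R : realType) (K X Y : R) : 0 <= K -> 0 <= Y ->
  (forall d, 0 < d -> X <= expR (K * d) * Y) -> X <= Y.
Proof.
move=> K0 Y0 XY; rewrite leNgt; apply/negP => YX.
have {}K0 : 0 < K + 1 by lra.
case: (eqVneq Y 0) => [Y0'|Yn0].
  by have := XY 1 ltr01; rewrite Y0' mulr0 leNgt -Y0' YX.
have {}Y0 : 0 < Y by rewrite lt_neqAle eq_sym Yn0.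
pose q := ln (X / Y) / 2.
have q0 : 0 < q by rewrite divr_gt0 // ln_gt0 // ltr_pdivlMr // mul1r.
have := XY (q / (K + 1)) (divr_gt0 q0 K0); apply/negP; rewrite -ltNge.
rewrite -ltr_pdivlMr // -[X / Y]lnK ?posrE ?divr_gt0 //; last exact: lt_trans YX.
rewrite ltr_expR; have -> : ln (X / Y) = 2 * q by rewrite /q; field.
rewrite mulrA ltr_pdivrMr //; nra.
Qed.

(* Tangent-line bounds for exp at [r] (for the index [k0]) and at [- r / m] (for the others). *)
Lemma sum_expR_ge (R : realType) m (w : 'I_m.+1 -> R) (r : R) k0 :
  (0 < m)%N -> 0 <= r -> r <= w k0 -> \sum_k w k = 0 ->
  expR r + m%:R * expR (- (r / m%:R)) <= \sum_k expR (w k).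
Proof.
move=> m0 r0 rw sw; set p := - (r / m%:R).
have tangent y x : expR y * (1 + x - y) <= expR x :> R.
  have -> : expR x = expR y * expR (x - y) by rewrite -expRD addrCA subrr addr0.
  by rewrite ler_pM2l ?expR_gt0 // -addrA expR_ge1Dx.
have pr : expR p <= expR r.
  by rewrite ler_expR (le_trans _ r0) // /p oppr_le0 divr_ge0 // ler0n.
rewrite (bigD1 k0) //=.
have sumT : \sum_(k | k != k0) expR p * (1 + w k - p) = expR p * (m%:R - w k0 + r).
  have sw' : \sum_(k | k != k0) w k = - w k0.
    by apply/eqP; rewrite -addr_eq0 addrC; move: sw; rewrite (bigD1 k0) //= => ->.
  rewrite -mulr_sumr sumrB big_split /= sw' !sumr_const.
  have -> : #|[pred k | k != k0]| = m by have := cardC1 k0; rewrite card_ord.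
  rewrite /p mulNrn opprK -[(r / _) *+ m]mulr_natr divfK ?pnatr_eq0 -?lt0n //.
have h1 := tangent r (w k0).
have h2 : expR p * (m%:R - w k0 + r) <= \sum_(k | k != k0) expR (w k).
  by rewrite -sumT ler_sum.
apply: le_trans (lerD h1 h2).
have : 0 <= (w k0 - r) * (expR r - expR p) by rewrite mulr_ge0 ?subr_ge0.
nra.
Qed.

Lemma normr_exprz (R : numFieldType) (x : R) (k : int) : `|x ^ k| = `|x| ^ k.
Proof. by case: k => k; rewrite /exprz ?normfV normrX. Qed.

Section UnitReducible.
Variables (R : realType) (L : fieldExtType rat) (m : nat).
Variables (sigma : 'I_m.+1 -> {rmorphism L -> R}) (b : 'I_m.+1 -> L) (eps : 'I_m -> L).
Hypotheses (sigma_inj : real_embeddings sigma) (hb : integral_basis b).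
Hypothesis heps : fundamental_units eps.

Local Notation w := (widen_ord (leqnSn m)).

(** The last embedding is left out because the norm of a unit determines it; the factor 2 comes from
    [ln (u^2)], as [u^2] is what enters the trace. *)
Definition log_mx : 'M[R]_m := \matrix_(j, i) (2 * ln `|sigma (w i) (eps j)|).

Lemma emb_dense (y : 'I_m.+1 -> R) (e : R) : 0 < e ->
  exists c : L, forall k, `|sigma k c - y k| < e.
Proof.
move=> e0; have Eu := integral_basis_unit sigma_inj hb.
pose v : 'rV[R]_m.+1 := (\row_k y k) *m invmx (emb_mx sigma b).
pose K := \sum_i \sum_k `|emb_mx sigma b i k| + 1.
have K0 : 0 < K by rewrite ltr_wpDl // sumr_ge0 // => i _; rewrite sumr_ge0.
have ent i k : `|emb_mx sigma b i k| <= K.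
  rewrite /K (bigD1 i) //= (bigD1 k) //= -!addrA lerDl !addr_ge0 ?sumr_ge0 // => *.
  exact: sumr_ge0.
pose d := e / (m.+1%:R * K * m.+2%:R).
have d0 : 0 < d by rewrite divr_gt0 // !mulr_gt0.
have /choice[q qP] : forall i, exists q : rat, `|ratr q - v 0 i| <= d.
  move=> i; have /rat_in_itvoo[q] : v 0 i - d < v 0 i + d by lra.
  by rewrite in_itv /= => /andP[h1 h2]; exists q; rewrite ler_norml; apply/andP; split; lra.
exists (\sum_i q i *: b i) => k.
pose z : 'rV[R]_m.+1 := \row_i ratr (q i) - v.
have Dz : (z *m emb_mx sigma b) 0 k = sigma k (\sum_i q i *: b i) - y k.
  rewrite mulmxBl mulmxKV // mxE [X in _ + X]mxE [X in _ - X]mxE mxE rmorph_sum.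
  by congr (_ - _); apply: eq_bigr => i _; rewrite rmorph_scale_rat !mxE.
rewrite -Dz; apply: le_lt_trans (le_l1 _ k) _.
apply: le_lt_trans (l1_mulmx _ ent) _.
have lz : l1 z <= m.+1%:R * d.
  apply: le_trans (_ : \sum_(i < m.+1) d <= _).
    by apply: ler_sum => i _; rewrite /z mxE [X in X + _]mxE [X in _ + X]mxE qP.
  by rewrite sumr_const card_ord -[leLHS]mulr_natl.
apply: le_lt_trans (_ : m.+1%:R * K * (m.+1%:R * d) < e).
  by rewrite ler_pM2l // mulr_gt0.
have -> : m.+1%:R * K * (m.+1%:R * d) = e * (m.+1%:R / m.+2%:R).
  rewrite /d; have : m.+1%:R != 0 :> R by [].
  have : m.+2%:R != 0 :> R by [].
  by move: m.+1%:R m.+2%:R => a a' ? ?; field; rewrite (gt_eqF K0); apply/and3P.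
by rewrite gtr_pMr // ltr_pdivrMr // mul1r ltr_nat.
Qed.

Lemma unit_log (u : L) : is_unitK u -> exists k : 'rV[int]_m,
  (forall i, sigma (w i) u ^+ 2 = expR ((map_mx intr k *m log_mx) 0 i)) /\
  sigma ord_max u ^+ 2 = expR (- \sum_i (map_mx intr k *m log_mx) 0 i).
Proof.
move=> uU; have [s [k Du]] := heps.2 u uU; exists (\row_j k j).
have eps0 i j : 0 < `|sigma i (eps j)|.
  by rewrite normr_gt0 fmorph_eq0; case: (heps.1 j).
have H i : sigma (w i) u ^+ 2 = expR ((map_mx intr (\row_j k j) *m log_mx) 0 i).
  rewrite -[LHS]real_normK ?num_real // Du rmorphM rmorphXn rmorphN1 normrM normrX normrN1.
  rewrite expr1n mul1r rmorph_prod normr_prod -prodrXl mxE expR_sum.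
  apply: eq_bigr => j _; rewrite fmorphXz normr_exprz !mxE.
  rewrite -powR_intmul ?ltW // /powR gt_eqF // -expRM_natl; congr expR; ring.
split=> //.
have prodE : \prod_i sigma i u ^+ 2 = 1.
  by rewrite prodrXl -[LHS]real_normK ?num_real // (unit_emb_prod sigma_inj hb) // expr1n.
rewrite expRN expR_sum.
move: prodE; rewrite big_ord_recr /= => prodE.
apply: (mulfI (_ : \prod_i sigma (w i) u ^+ 2 != 0)).
  by apply/prodf_neq0 => i _; rewrite expf_neq0 // fmorph_eq0; case: uU.
rewrite {}prodE (eq_bigr _ (fun i _ => H i)) mulfV //.
by apply/prodf_neq0 => i _; rewrite gt_eqF ?expR_gt0.
Qed.

Lemma det_log_mx :
  `|\det log_mx| = 2 ^+ m * regulator_of sigma (eps : 'I_m.+1.-1 -> L).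
Proof.
rewrite /regulator_of -[2]ger0_norm // -normrX -normrM -detZ -[in RHS]det_tr.
congr (`|\det _|); apply/matrixP => j i; rewrite !mxE.
by congr (_ * ln `|sigma _ _|); apply: val_inj.
Qed.

(** The slack adds up as follows, with [n = m + 1]: [2 n] from the lower bound on the trace raised
    to the power [n], [2 n] from the norm of [a], and [C(n, 2)] from using [(4/3) e^d] as Hermite
    constant. *)
Lemma unit_reducible_hermite (r d : R) : \dim {:L} = m.+1 -> totally_real L ->
  unit_reducible L -> (0 < m)%N -> 0 <= r -> 0 < d ->
  (m.+1%:R * r) ^+ m < m`!%:R * (2 ^+ m * regulator_of sigma (eps : 'I_m.+1.-1 -> L)) ->
  (expR r + m%:R * expR (- (r / m%:R))) ^+ m.+1 <=
  expR (((4 * m.+1 + 'C(m.+1, 2))%:R) * d) *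
    ((4 / 3) ^+ 'C(m.+1, 2) * ratr (disc_of_basis b)).
Proof.
move=> Dn hTR redL m0 r0 d0; rewrite -det_log_mx => /(lattice_covering r0)[al alP].
(* Completes the hole by a last coordinate that makes the sum zero, as for the logarithms of a
   unit. *)
pose t k : R := if unlift ord_max k is Some i then al 0 i else - \sum_i al 0 i.
have tw i : t (w i) = al 0 i.
  have -> : w i = lift ord_max i by apply: val_inj; rewrite /= /bump leqNgt ltn_ord.
  by rewrite /t liftK.
have tmax : t ord_max = - \sum_i al 0 i by rewrite /t unlift_none.
have t_sum : \sum_k t k = 0.
  by rewrite big_ord_recr /= tmax (eq_bigr _ (fun i _ => tw i)) subrr.
pose T := \sum_k `|t k / 2|.
have tT k : - T <= t k / 2.
  have : `|t k / 2| <= T by rewrite /T (bigD1 k) //= lerDl sumr_ge0.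
  by rewrite ler_norml => /andP[].
(* Since [e^(-T) <= e^(t_k / 2)] for all [k], an absolute error of this size is a factor between
   [e^(-d)] and [e^d] in every conjugate. *)
have e0 : 0 < expR (- T) * (1 - expR (- d)).
  by rewrite mulr_gt0 ?expR_gt0 // subr_gt0 expR_lt1 oppr_lt0.
have [c cP] := emb_dense (fun k => expR (t k / 2)) e0.
have c_bounds k : expR (t k / 2 - d) <= sigma k c <= expR (t k / 2 + d).
  have := cP k; rewrite ltr_norml => /andP[h1 h2].
  have h3 : expR (- T) * (1 - expR (- d)) <= expR (t k / 2) * (1 - expR (- d)).
    by rewrite ler_wpM2r ?ler_expR // subr_ge0 expR_le1 oppr_le0 ltW.
  rewrite !expRD; apply/andP; split; first by lra.
  have h4 : 2 - expR (- d) <= expR d.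
    have := expR_ge1Dx d; rewrite expRN => h.
    have : 0 < expR d by exact: expR_gt0.
    move: (expR d) h => q h q0.
    have -> : 2 - q^-1 = q - (q - 1) ^+ 2 / q by field; rewrite gt_eqF.
    by rewrite lerBlDr lerDl divr_ge0 ?sqr_ge0 ?ltW.
  have := expR_gt0 (t k / 2); nra.
have c_gt0 k : 0 < sigma k c.
  by have /andP[+ _] := c_bounds k; apply: lt_le_trans; exact: expR_gt0.
have c0 : c != 0 by have := c_gt0 ord0; apply: contraTneq => ->; rewrite rmorph0 ltxx.
(* Total positivity refers to embeddings into [algC]; the square of a nonzero element with real
   values is positive under each, however they correspond to [sigma]. *)
have tpos : totally_positive (c ^+ 2).
  by move=> f; rewrite rmorphXn real_exprn_even_gt0 //= ?hTR // fmorph_eq0.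
have [u [uU uP]] := redL _ tpos.
pose a := c ^+ 2; pose S := expR r + m%:R * expR (- (r / m%:R)).
have S0 : 0 < S by rewrite ltr_pwDl ?expR_gt0 // mulr_ge0 ?expR_ge0.
have a_bounds k : expR (t k - 2 * d) <= sigma k a <= expR (t k + 2 * d).
  have /andP[h1 h2] := c_bounds k.
  have -> : t k - 2 * d = 2%:R * (t k / 2 - d) by field.
  have -> : t k + 2 * d = 2%:R * (t k / 2 + d) by field.
  rewrite !expRM_natl rmorphXn /=.
  by rewrite !lerXn2r ?nnegrE ?expR_ge0 // ltW.
have a_gt0 k : 0 < sigma k a by rewrite rmorphXn exprn_gt0.
pose lam := expR (- (2 * d)) * S.
have lam0 : 0 < lam by rewrite mulr_gt0 ?expR_gt0.
have lam_le : lam <= ratr (traceK (a * u ^+ 2)).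
  rewrite (traceK_emb _ Dn sigma_inj).
  have [k [kw kmax]] := unit_log uU.
  pose v := al + map_mx intr k *m log_mx.
  (* A translate of the hole by a vector of the unit lattice, so one of its coordinates exceeds
     [r]. *)
  pose z i := t i + ln (sigma i u ^+ 2).
  have zw i : z (w i) = v 0 i by rewrite /z tw kw expRK [RHS]mxE.
  have zmax : z ord_max = - \sum_i v 0 i.
    rewrite /z tmax kmax expRK -opprD -big_split; congr (- _).
    by apply: eq_bigr => i _; rewrite [RHS]mxE.
  have z_sum : \sum_i z i = 0.
    by rewrite big_ord_recr /= zmax (eq_bigr _ (fun i _ => zw i)) subrr.
  have [k0 rk0] : exists k0, r <= z k0.
    have [[i ri]|rmax] := alP k.
      by exists (w i); rewrite zw ltW.
    by exists ord_max; rewrite zmax ltW.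
  have := sum_expR_ge m0 r0 rk0 z_sum; rewrite -/S => leS.
  apply: le_trans (_ : expR (- (2 * d)) * \sum_i expR (z i) <= _).
    by rewrite ler_pM2l ?expR_gt0.
  rewrite mulr_sumr ler_sum // => i _; rewrite rmorphM rmorphXn.
  have u2 : 0 < sigma i u ^+ 2 by rewrite exprn_even_gt0 //= fmorph_eq0; case: uU.
  rewrite /z expRD lnK ?posrE // mulrA ler_pM2r // -expRD addrC.
  by case/andP: (a_bounds i).
(* Gram matrix of [Tr (a x^2)] in the integral basis. As the [t_k] sum to zero, the norm of [a] is 1
   up to slack. *)
pose G : 'M[R]_m.+1 :=
  emb_mx sigma b *m diag_mx (\row_k sigma k a) *m (emb_mx sigma b)^T.
have symG : G^T = G by rewrite /G !trmx_mul trmxK tr_diag_mx mulmxA.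
have qG (x : 'rV[int]_m.+1) : x != 0 -> lam <= qform G (map_mx intr x).
  move=> x0; apply: le_trans lam_le _.
  have [y [yI y0 Dy]] := integral_of_coordinates sigma_inj hb x0.
  apply: le_trans (_ : ratr (traceK (a * y ^+ 2)) <= _).
    by rewrite ler_rat uP.
  rewrite (traceK_emb _ Dn sigma_inj) qform_mulmx /qform mul_mx_diag mxE.
  apply: ler_sum => k _; rewrite [(_^T) _ _]mxE Dy [(\matrix_(i, j) _) _ _]mxE Dy mxE.
  rewrite rmorphM rmorphXn /= le_eqVlt; apply/orP; left; apply/eqP.
  by move: (sigma k a) => s; ring.
have c43 : 4 / 3 < 4 / 3 * expR d :> R.
  by rewrite ltr_pMr ?divr_gt0 // expR_gt1.
have := hermite_bound c43 symG lam0 qG.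
have detG : \det G <= expR ((m.+1%:R * 2) * d) * ratr (disc_of_basis b).
  rewrite (disc_emb b Dn sigma_inj) /G !det_mulmx det_tr mulrAC -expr2 mulrC.
  rewrite ler_wpM2r ?sqr_ge0 // det_diag.
  apply: le_trans (_ : \prod_k expR (t k + 2 * d) <= _).
    apply: ler_prod => k _; rewrite mxE ltW //=.
    by case/andP: (a_bounds k).
  by rewrite -expR_sum big_split /= t_sum add0r sumr_const card_ord -[(2 * d) *+ _]mulr_natl mulrA.
move=> /le_trans/(_ (ler_wpM2l _ detG)).
rewrite exprn_ge0 ?mulr_ge0 ?divr_ge0 ?expR_ge0 // => /(_ isT).
rewrite /lam exprMn -expRM_natl exprMn -[expR d ^+ _]expRM_natl => H.
rewrite -/S -(@ler_pM2l _ (expR (m.+1%:R * - (2 * d)))) ?expR_gt0 //.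
apply: le_trans H _.
rewrite [leRHS]mulrA -expRD le_eqVlt; apply/orP; left; apply/eqP.
have -> : m.+1%:R * - (2 * d) + (4 * m.+1 + 'C(m.+1, 2))%:R * d =
    'C(m.+1, 2)%:R * d + m.+1%:R * 2 * d by rewrite natrD natrM; ring.
by rewrite expRD; ring.
Qed.

End UnitReducible.

(** * The Gamma function at half-integers *)

Section GammaHalfIntegers.
Variable R : realType.
Local Notation mu := (@lebesgue_measure R).

(** The integrand of Gamma at [s + 1]: with this shift only exponents [s >= 0] occur, and the
    integrand is continuous up to 0. *)
Definition gamma_fun (s t : R) : R := t `^ s * expR (- t).

Lemma gamma_fun_ge0 s t : 0 <= gamma_fun s t.
Proof. by rewrite mulr_ge0 ?powR_ge0 ?expR_ge0. Qed.

Lemma measurable_gamma_fun s : measurable_fun setT (gamma_fun s).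
Proof.
apply: measurable_funM; first exact: measurable_powR.
by apply: measurableT_comp; [exact: measurable_expR | exact: oppr_measurable].
Qed.

Lemma within_continuous_powR (s N : R) : 0 <= s -> 0 < N ->
  {within `[0, N], continuous (fun t : R => t `^ s)}.
Proof.
rewrite le_eqVlt => /predU1P[<-|s0] N0.
  have -> : (fun t : R => t `^ 0) = cst 1 by apply/funext => t; rewrite powRr0.
  by apply: continuous_subspaceT => x; exact: cst_continuous.
have ct t : 0 < t -> {for t, continuous (fun t : R => t `^ s)}.
  move=> t0; apply/differentiable_continuous/derivable1_diffP.
  by apply: derivable_powR; rewrite in_itv /= t0.
apply/continuous_within_itvP => //; split => [t||].
- by rewrite in_itv /= => /andP[t0 _]; exact: ct.
- by rewrite powR0 ?gt_eqF //; exact: powR_cvg0.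
- by apply: cvg_at_left_filter; exact: ct.
Qed.

Lemma within_continuous_gamma_fun (s N : R) : 0 <= s -> 0 < N ->
  {within `[0, N], continuous (gamma_fun s)}.
Proof.
move=> s0 N0; apply/subspace_continuousP => x Nx; apply: cvgM.
  by move/subspace_continuousP: (within_continuous_powR s0 N0); apply.
move: x Nx; apply/subspace_continuousP; apply: continuous_subspaceT => x.
by apply: continuous_comp; [exact: opp_continuous | exact: continuous_expR].
Qed.

Lemma continuous_opp_expRN : continuous (fun t : R => - expR (- t)).
Proof.
move=> x; apply: cvgN.
by apply: continuous_comp; [exact: opp_continuous | exact: continuous_expR].
Qed.

Lemma derive_opp_expRN (x : R) :
  is_derive x 1 (fun t : R => - expR (- t)) (expR (- x)).
Proof. by apply: is_derive_eq; rewrite mulrN1 opprK. Qed.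

Lemma derive_opp_expRN_sqr (x : R) :
  is_derive x 1 (fun t : R => - expR (- t ^+ 2)) (2 * x * expR (- x ^+ 2)).
Proof.
by apply: is_derive_eq; rewrite /GRing.scale /= mulr1; ring.
Qed.

Lemma LR_continuous (F : R -> R) (a b : R) : continuous F ->
  (forall x, derivable F x 1) -> derivable_oo_LRcontinuous F a b.
Proof.
move=> cF dF; split=> [x _||]; first exact: dF.
  by apply: cvg_at_right_filter; exact: cF.
by apply: cvg_at_left_filter; exact: cF.
Qed.

Lemma gamma_by_parts (s N : R) : 0 <= s -> 0 < N ->
  (\int[mu]_(t in `[0%R, N]) (gamma_fun (s + 1) t)%:E =
   (- gamma_fun (s + 1) N)%:E +
   (s + 1)%:E * \int[mu]_(t in `[0%R, N]) (gamma_fun s t)%:E)%E.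
Proof.
move=> s0 N0; have s1 : 0 < s + 1 by rewrite ltr_wpDl.
rewrite (@integration_by_parts _ (fun t => t `^ (s + 1)) (fun t => - expR (- t))
  (fun t => (s + 1) * t `^ s) (fun t => expR (- t))) //; first last.
- by move=> x _; rewrite derive1E (@derive_val _ _ _ _ _ _ _ (derive_opp_expRN x)).
- apply: LR_continuous => [|x]; first exact: continuous_opp_expRN.
  exact: (@ex_derive _ _ _ _ _ _ _ (derive_opp_expRN x)).
- apply: continuous_subspaceT => x.
  by apply: continuous_comp; [exact: opp_continuous | exact: continuous_expR].
- move=> x; rewrite in_itv /= => /andP[x0 _].
  by rewrite powR_derive1 ?in_itv /= ?x0 // addrK.
- split.
  + by move=> x; rewrite in_itv /= => /andP[x0 _]; apply: derivable_powR; rewrite in_itv /= x0.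
  + by rewrite powR0 ?gt_eqF //; exact: powR_cvg0.
  + apply: cvg_at_left_filter.
    have : {for N, continuous (fun t : R => t `^ (s + 1))}; last exact.
    apply/differentiable_continuous/derivable1_diffP.
    by apply: derivable_powR; rewrite in_itv /= N0.
- apply/subspace_continuousP => x Nx; apply: cvgM; first exact: cvg_cst.
  by move/subspace_continuousP: (within_continuous_powR s0 N0); apply.
rewrite powR0 ?gt_eqF // mul0r subr0 mulrN; congr (_ + _)%E.
have -> : (\int[mu]_(x in `[0%R, N]) ((s + 1) * x `^ s * - expR (- x))%:E =
    \int[mu]_(x in `[0%R, N]) ((- (s + 1))%:E * (gamma_fun s x)%:E))%E.
  by apply: eq_integral => x _; rewrite -EFinM /gamma_fun; congr EFin; ring.
rewrite integralZl //; last first.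
  apply: continuous_compact_integrable; first exact: segment_compact.
  exact: within_continuous_gamma_fun.
by rewrite EFinN mulNe oppeK.
Qed.

Lemma cvg_gamma_fun (s : R) : gamma_fun s n%:R @[n --> \oo] --> 0.
Proof.
pose k := (Num.truncn `|s|).+1.
have sk : s <= k%:R.
  by apply: le_trans (ler_norm _) _; have /andP[_ /ltW] := truncn_itv (normr_ge0 s).
rewrite -cvg_shiftS /=.
apply: (@squeeze_cvgr _ _ _ _ (cst 0) (fun n => k.+1`!%:R * harmonic n)).
- near=> n; rewrite gamma_fun_ge0 /= /gamma_fun /harmonic.
  have n0 : 0 < n.+1%:R :> R by [].
  apply: le_trans (_ : n.+1%:R ^+ k * expR (- n.+1%:R) <= _).
    by rewrite ler_wpM2r ?expR_ge0 // -powR_mulrn // ler_powR // ler1n.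
  rewrite expRN ler_pdivrMr ?expR_gt0 // mulrAC ler_pdivlMr //.
  have := expR_ge1Dxn k (ltW n0); set e := expR _ => h.
  have {}h : n.+1%:R ^+ k.+1 / k.+1`!%:R <= e by apply: le_trans h; rewrite lerDr.
  by rewrite ler_pdivrMr ?ltr0n ?fact_gt0 // in h; rewrite -exprSr mulrC.
- exact: cvg_cst.
- rewrite -[X in _ --> X](mulr0 k.+1`!%:R).
  by apply: cvgM; [exact: cvg_cst | exact: cvg_harmonic].
Unshelve. all: by end_near.
Qed.

Definition gamma_int (s : R) : \bar R :=
  (\int[mu]_(t in `]0%R, +oo[) (gamma_fun s t)%:E)%E.

Lemma gamma_int_cvg s :
  (\int[mu]_(t in `[0%R, n%:R]) (gamma_fun s t)%:E)%E @[n --> \oo] --> gamma_int s.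
Proof.
rewrite /gamma_int integral_itv_obnd_cbnd; last first.
  by apply: measurable_funTS; apply/measurable_EFinP; exact: measurable_gamma_fun.
apply: ge0_cvgn_integral; [exact: gamma_fun_ge0 | exact: measurable_gamma_fun].
Qed.

Lemma gamma_int_rec (s v : R) : 0 <= s -> gamma_int s = v%:E ->
  gamma_int (s + 1) = ((s + 1) * v)%:E.
Proof.
move=> s0 Is; have H := @gamma_int_cvg (s + 1).
apply: (cvg_unique _ H) => //.
have : ((- gamma_fun (s + 1) n%:R)%:E +
    (s + 1)%:E * \int[mu]_(t in `[0%R, n%:R]) (gamma_fun s t)%:E)%E @[n --> \oo]
    --> ((- 0)%:E + (s + 1)%:E * v%:E)%E.
  apply: cvgeD => //.
    by apply: cvg_EFin; [near=> n | apply: cvgN; exact: cvg_gamma_fun].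
  by apply: cvgeZl => //; rewrite -Is; exact: gamma_int_cvg.
rewrite oppr0 add0e -EFinM; apply: cvg_trans; apply: near_eq_cvg; near=> n.
have n0 : 0 < n%:R :> R by rewrite ltr0n; near: n; exact: nbhs_infty_gt.
by rewrite (gamma_by_parts s0 n0).
Unshelve. all: by end_near.
Qed.

Lemma gamma_int0 : gamma_int 0 = 1%:E.
Proof.
rewrite /gamma_int integral_itv_obnd_cbnd; last first.
  by apply: measurable_funTS; apply/measurable_EFinP; exact: measurable_gamma_fun.
under eq_integral => t _ do rewrite /gamma_fun powRr0 mul1r.
rewrite (@ge0_continuous_FTC2y _ (fun t => expR (- t)) (fun t => - expR (- t)) 0 0) //=; first last.
- by move=> x _; rewrite derive1E (@derive_val _ _ _ _ _ _ _ (derive_opp_expRN x)).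
- by apply: cvg_at_right_filter; exact: continuous_opp_expRN.
- by rewrite -[X in _ --> X]oppr0; apply: cvgN; exact: cvgr_expR.
- apply: continuous_subspaceT => x.
  by apply: continuous_comp; [exact: opp_continuous | exact: continuous_expR].
- by rewrite oppr0 expR0 -EFinB opprK add0r.
Qed.

Lemma gauss_by_parts (N : R) : 0 < N ->
  (\int[mu]_(x in `[0%R, N]) (x * (2 * x * expR (- x ^+ 2)))%:E =
   (- (N * expR (- N ^+ 2)))%:E + \int[mu]_(x in `[0%R, N]) (gauss_fun x)%:E)%E.
Proof.
move=> N0; rewrite (@integration_by_parts _ id (fun t => - expR (- t ^+ 2))
  (fun=> 1) (fun x => 2 * x * expR (- x ^+ 2))) //; first last.
- by move=> x _; rewrite derive1E (@derive_val _ _ _ _ _ _ _ (derive_opp_expRN_sqr x)).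
- apply: LR_continuous => x; last exact: (@ex_derive _ _ _ _ _ _ _ (derive_opp_expRN_sqr x)).
  by apply: cvgN; exact: continuous_gauss_fun.
- apply: continuous_subspaceT => x; apply: cvgM; last exact: continuous_gauss_fun.
  by apply: cvgM; [exact: cvg_cst | exact: cvg_id].
- by move=> x _; rewrite derive1E derive_id.
- by apply: LR_continuous => x; [exact: cvg_id | exact: derivable_id].
- by apply: continuous_subspaceT => x; exact: cst_continuous.
rewrite mul0r subr0 mulrN; congr (_ + _)%E.
have -> : (\int[mu]_(x in `[0%R, N]) (1 * - expR (- x ^+ 2))%:E =
    \int[mu]_(x in `[0%R, N]) ((- 1)%:E * (gauss_fun x)%:E))%E.
  by apply: eq_integral => x _; rewrite -EFinM /gauss_fun; congr EFin; ring.
rewrite integralZl //; last first.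
  apply: continuous_compact_integrable; first exact: segment_compact.
  by apply: continuous_subspaceT; exact: continuous_gauss_fun.
by rewrite EFinN mulNe mul1e oppeK.
Qed.

(** Substitution [t = x^2]. The result is kept as [x] times the derivative of [- e^(-x^2)], ready
    for the integration by parts that leads to the Gaussian integral. *)
Lemma gamma_half_substitution (N : R) : 0 < N ->
  (\int[mu]_(t in `[0%R, (N ^+ 2)%R]) (gamma_fun 2^-1 t)%:E =
   \int[mu]_(x in `[0%R, N]) (x * (2 * x * expR (- x ^+ 2)))%:E)%E.
Proof.
move=> N0; pose F (x : R) : R := x ^+ 2.
have dF (x : R) : is_derive x 1 F (2 * x).
  by rewrite /F; apply: is_derive_eq; rewrite /GRing.scale /=; ring.
have F' : (F^`())%classic = fun x => 2 * x.
  by apply/funext => x; rewrite derive1E (@derive_val _ _ _ _ _ _ _ (dF x)).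
have cF' : continuous (fun x : R => 2 * x).
  by move=> x; apply: cvgM; [exact: cvg_cst | exact: cvg_id].
have F0 : F 0 = 0 by rewrite /F expr0n.
have := @integration_by_substitution_increasing _ F (gamma_fun 2^-1) 0 N (ltW N0).
rewrite F0 F' => ->.
- apply: eq_integral => x; rewrite inE /= in_itv /= => /andP[x0 _].
  congr EFin; rewrite -[LHS]/(gamma_fun 2^-1 (x ^+ 2) * (2 * x)) /gamma_fun.
  have -> : (x ^+ 2) `^ 2^-1 = x by rewrite powR12_sqrt ?sqr_ge0 // sqrtr_sqr ger0_norm.
  by ring.
- move=> x y; rewrite !in_itv /= => /andP[x0 _] /andP[y0 _] xy.
  by rewrite /F ltr_pXn2r.
- by move=> x _; exact: cF'.
- by apply/cvg_ex; exists (2 * 0); apply: cvg_at_right_filter; exact: cF'.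
- by apply/cvg_ex; exists (2 * N); apply: cvg_at_left_filter; exact: cF'.
- apply: LR_continuous => x; last exact: (@ex_derive _ _ _ _ _ _ _ (dF x)).
  exact: exprn_continuous.
- by apply: within_continuous_gamma_fun; rewrite ?invr_ge0 ?exprn_gt0.
Qed.

Lemma gamma_int_half : gamma_int 2^-1 = (Num.sqrt pi / 2)%:E.
Proof.
(* The substitution sends [[0, n]] to [[0, n^2]], so the limit is taken along the squares. *)
have sqrn : ((n ^ 2)%N @[n --> \oo] --> \oo)%classic.
  apply/cvgnyPge => A; near=> n.
  have An : (A <= n)%N by near: n; exact: nbhs_infty_ge.
  by rewrite (leq_trans An) //; case: (n) => // k; rewrite -mulnn leq_pmulr.
have H := cvg_comp _ _ sqrn (@gamma_int_cvg 2^-1).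
apply: (cvg_unique _ H) => //.
have : ((- (n%:R * expR (- n%:R ^+ 2)))%:E +
   \int[mu]_(x in `[0%R, n%:R]) (gauss_fun x)%:E)%E @[n --> \oo]
    --> ((- 0)%:E + (Num.sqrt pi / 2)%:E)%E.
  apply: cvgeD => //.
    apply: cvg_EFin; [by near=> n | apply: cvgN].
    apply: (@squeeze_cvgr _ _ _ _ (cst 0) (fun n => gamma_fun 1 n%:R)).
    - near=> n; rewrite mulr_ge0 ?expR_ge0 //= /gamma_fun powRr1 //.
      rewrite ler_wpM2l // ler_expR lerN2 expr2.
      by case: (n) => [|k]; rewrite ?mul0r // ler_peMl // ler1n.
    - exact: cvg_cst.
    - exact: cvg_gamma_fun.
  rewrite -integral0y_gauss.
  by apply: ge0_cvgn_integral; [exact: gauss_fun_ge0 | exact: measurable_gauss_fun].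
rewrite oppr0 add0e; apply: cvg_trans; apply: near_eq_cvg; near=> n.
have n0 : 0 < n%:R :> R by rewrite ltr0n; near: n; exact: nbhs_infty_gt.
by rewrite /= natrX gamma_half_substitution // gauss_by_parts.
Unshelve. all: by end_near.
Qed.

(** Closed form of Gamma at [n/2 + 1], started from the values at 1 and 3/2. *)
Fixpoint gamma_half (n : nat) : R :=
  match n with
  | 0 => 1
  | 1 => Num.sqrt pi / 2
  | n'.+2 => (n'%:R / 2 + 1) * gamma_half n'
  end.

Lemma GammaE n : Gamma (n%:R / 2 + 1 : R) = gamma_half n.
Proof.
have E : forall k, gamma_int (k%:R / 2) = (gamma_half k)%:E /\
    gamma_int (k.+1%:R / 2) = (gamma_half k.+1)%:E.
  elim=> [|k [IH1 IH2]]; first by rewrite mul0r mul1r gamma_int0 gamma_int_half.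
  split=> //; have -> : k.+2%:R / 2 = k%:R / 2 + 1 :> R by rewrite -addn2 natrD; field.
  by rewrite (gamma_int_rec _ IH1) // divr_ge0.
rewrite /Gamma; have [+ _] := E n; rewrite /gamma_int /gamma_fun => En.
by under eq_integral => t _ do rewrite addrK; rewrite En.
Qed.

End GammaHalfIntegers.

(** * A bound on pi *)

Section PiBound.
Variable R : realType.

Lemma ge0_of_derive_ge0 (f g : R -> R) : (forall x : R, is_derive x 1 f (g x)) ->
  f 0 = 0 -> (forall x, 0 <= x -> 0 <= g x) -> forall x, 0 <= x -> 0 <= f x.
Proof.
move=> df f0 g0 x; rewrite le_eqVlt => /predU1P[<-|x0]; first by rewrite f0.
have [|c] := @MVT _ f g 0 x x0 (fun y _ => df y).
  by apply: derivable_within_continuous => y _; exact: (@ex_derive _ _ _ _ _ _ _ (df y)).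
rewrite in_itv /= f0 !subr0 => /andP[c0 _] ->.
by apply: mulr_ge0; [apply/g0/ltW | exact: ltW].
Qed.

(** Obtained from [cos x <= 1] by integrating four times from 0. *)
Lemma cos_le_taylor4 (x : R) : 0 <= x -> cos x <= 1 - x ^+ 2 / 2 + x ^+ 4 / 24.
Proof.
have h1 : forall x : R, 0 <= x -> 0 <= x - sin x.
  apply: (@ge0_of_derive_ge0 _ (fun x => 1 - cos x)) => [|y _].
  - by rewrite sin0 subr0.
  - by rewrite subr_ge0 cos_le1.
have h2 : forall x : R, 0 <= x -> 0 <= cos x - 1 + x ^+ 2 / 2.
  apply: (@ge0_of_derive_ge0 _ (fun x => x - sin x)) => // [y|]; last first.
    by rewrite cos0 expr0n mul0r subrr addr0.
  by apply: is_derive_eq; rewrite /GRing.scale /=; lra.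
have h3 : forall x : R, 0 <= x -> 0 <= sin x - x + x ^+ 3 / 6.
  apply: (@ge0_of_derive_ge0 _ (fun x => cos x - 1 + x ^+ 2 / 2)) => // [y|]; last first.
    by rewrite sin0 expr0n mul0r subrr addr0.
  by apply: is_derive_eq; rewrite /GRing.scale /=; lra.
have h4 : forall x : R, 0 <= x -> 0 <= 1 - x ^+ 2 / 2 + x ^+ 4 / 24 - cos x.
  apply: (@ge0_of_derive_ge0 _ (fun x => sin x - x + x ^+ 3 / 6)) => // [y|]; last first.
    by rewrite cos0 !expr0n !mul0r subr0 addr0 subrr.
  by apply: is_derive_eq; rewrite /GRing.scale /=; lra.
by move=> /h4; rewrite subr_ge0.
Qed.

(** At [x = pi / 4] the square of the cosine is 1/2, whereas [x^2 > 10/16] would push the Taylor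
    bound below 0.704, whose square is less than 1/2. *)
Lemma pi_sqr_le10 : (pi : R) ^+ 2 <= 10.
Proof.
rewrite leNgt; apply/negP => pi10.
have pi4 : (pi : R) < 4 by have := @pihalf_lt2 R; lra.
have pi0 := @pi_ge0 R.
pose x : R := pi / 4.
have x0 : 0 <= x by rewrite divr_ge0.
have cx : cos x ^+ 2 = 1 / 2.
  have := @cos_pihalf R; have -> : pi / 2 = x *+ 2 :> R by rewrite /x -mulr_natl; field.
  by rewrite cos_mulr2n -mulr_natl; lra.
have c0 : 0 <= cos x by apply: cos_ge0_pihalf; rewrite /x; apply/andP; split; lra.
have := cos_le_taylor4 x0.
have -> : x ^+ 4 = (x ^+ 2) ^+ 2 by rewrite -exprM.
have : x ^+ 2 = pi ^+ 2 / 16 by rewrite /x; field.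
have : pi ^+ 2 <= 16 :> R by nra.
move: (x ^+ 2) (pi ^+ 2) pi10 => X P h1 h2 h3 h4.
(* On [[10/16, 1]] the square lies below its chord, which makes the Taylor bound linear in [X]. *)
have h5 : (X - 10 / 16) * (1 - X) >= 0 by apply: mulr_ge0; lra.
have c704 : cos x <= 704 / 1000 by lra.
by nra.
Qed.
End PiBound.

(** * Real quadratic fields *)

Lemma sum_ord2 (V : nmodType) (F : 'I_2 -> V) : \sum_i F i = F 0 + F 1.
Proof. by rewrite big_ord_recl big_ord1; congr (F _ + F _); apply: val_inj. Qed.

Lemma prod_ord2 (A : comPzRingType) (F : 'I_2 -> A) : \prod_i F i = F 0 * F 1.
Proof. by rewrite big_ord_recl big_ord1; congr (F _ * F _); apply: val_inj. Qed.

Lemma det_mx2 (A : comNzRingType) (M : 'M[A]_2) :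
  \det M = M 0 0 * M 1 1 - M 0 1 * M 1 0.
Proof.
rewrite (expand_det_row _ 0) sum_ord2 /cofactor !det_mx11 !mxE /= expr0 mul1r.
rewrite expr1 mulN1r mulrN.
by congr (_ * M _ _ - _ * M _ _); apply: val_inj.
Qed.

Section QuadraticFields.
Variables (R : realType) (L : fieldExtType rat).
Variables (sigma : 'I_2 -> {rmorphism L -> R}) (b : 'I_2 -> L) (eps : 'I_1 -> L).
Hypotheses (sigma_inj : real_embeddings sigma) (hb : integral_basis b).
Hypothesis heps : fundamental_units eps.

(** The trace is obtained from norms alone: [N(x + 1) = N(x) + T + 1]. *)
Lemma integral_quadratic (x : L) : is_integral x -> exists T N : int,
  sigma 0 x + sigma 1 x = T%:~R /\ sigma 0 x * sigma 1 x = N%:~R.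
Proof.
move=> xI; have [N] := integral_emb_prod sigma_inj hb xI.
have x1I : is_integral (x - (-1)%:~R) by apply: is_integralB => //; exact: is_integral_int.
have [M] := integral_emb_prod sigma_inj hb x1I.
rewrite !prod_ord2 !rmorphB !rmorph_int => DM DN; exists (M - N - 1), N; split=> //.
by rewrite !rmorphB /= -DM -DN rmorphN rmorph1; ring.
Qed.

(* A coprime representation of 1 is completed by Bezout to the basis (1, x). *)
Lemma integral_generator : exists2 x : L, is_integral x &
  (sigma 1 x - sigma 0 x) ^+ 2 = (\det (emb_mx sigma b)) ^+ 2.
Proof.
have [c Dc] := hb.2 1 (is_integral_int L 1).
rewrite sum_ord2 in Dc; move: (c 0) (c 1) Dc => c0 c1 Dc.
have [u [v uv]] := Bezoutz c0 c1.
(* A common divisor [g] of the coordinates of 1 has an integral inverse; taking norms, [g^2] divides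
   1. *)
have g1 : gcdz c0 c1 = 1.
  set g := gcdz c0 c1; have [/dvdzP[d0 D0] /dvdzP[d1 D1]] :
    (g %| c0)%Z /\ (g %| c1)%Z by rewrite dvdz_gcdl dvdz_gcdr.
  pose y := d0%:~R * b 0 + d1%:~R * b 1.
  have yI : is_integral y.
    have -> : y = \sum_i (if i == 0 then d0 else d1)%:~R * b i by rewrite sum_ord2.
    by apply: is_integral_sum => i; apply: is_integralM; [exact: is_integral_int | exact: hb.1].
  have gy : g%:~R * y = 1 by rewrite [RHS]Dc D0 D1 !intrM /y; ring.
  have [T [N [_ DN]]] := integral_quadratic yI.
  have : (g%:~R * sigma 0 y) * (g%:~R * sigma 1 y) = 1.
    rewrite -[g%:~R in X in X * _](rmorph_int (sigma 0)) -(rmorph_int (sigma 1)) -!rmorphM.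
    by rewrite gy !rmorph1 mulr1.
  rewrite mulrACA DN -!intrM => /eqP; rewrite -[1]/(1%:~R) eqr_int => /eqP gN.
  have : g \is a GRing.unit.
    by apply/unitrP; exists (g * N); rewrite -gN; split; ring.
  by case/orP => /eqP // gN1; have : 0 <= g by []; rewrite gN1.
have E01 k : sigma k 1 = c0%:~R * sigma k (b 0) + c1%:~R * sigma k (b 1).
  by rewrite [in LHS]Dc rmorphD !rmorphM !rmorph_int.
exists (u%:~R * b 1 - v%:~R * b 0).
  by apply: is_integralB; apply: is_integralM; (exact: hb.1 || exact: is_integral_int).
rewrite det_mx2 !mxE !rmorphB !rmorphM !rmorph_int.
have uvR : u%:~R * c0%:~R + v%:~R * c1%:~R = 1 :> R by rewrite -!intrM -intrD uv g1.
have := E01 0; have := E01 1; rewrite !rmorph1 => e1 e0.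
congr (_ ^+ 2).
move: uvR e0 e1; move: (u%:~R : R) (v%:~R : R) (c0%:~R : R) (c1%:~R : R) => U V C0 C1 uvR.
move: (sigma 0 (b 0)) (sigma 0 (b 1)) (sigma 1 (b 0)) (sigma 1 (b 1)) => x y z t e0 e1.
have -> : U * t - V * z - (U * y - V * x) =
    (U * t - V * z) * (C0 * x + C1 * y) - (U * y - V * x) * (C0 * z + C1 * t).
  by rewrite -e0 -e1 !mulr1.
by rewrite -[RHS]mulr1 -uvR; ring.
Qed.

Lemma disc_quadratic : exists (x : L) (T N : int), [/\ is_integral x,
  sigma 0 x + sigma 1 x = T%:~R, sigma 0 x * sigma 1 x = N%:~R,
  sigma 1 x != sigma 0 x &
  (\det (emb_mx sigma b)) ^+ 2 = (T ^+ 2 - 4 * N)%:~R].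
Proof.
have [x xI Dx] := integral_generator; have [T [N [DT DN]]] := integral_quadratic xI.
exists x, T, N; split=> //.
  have := integral_basis_unit sigma_inj hb; rewrite unitmxE unitfE.
  by rewrite -sqrf_eq0 -Dx sqrf_eq0 subr_eq0.
by rewrite -Dx rmorphB rmorphXn rmorphM /= -DT -DN; ring.
Qed.

(* If the difference of the conjugates is rational then so is [x]. *)
Lemma emb_diff_irrational (x : L) (T f : int) :
  sigma 0 x + sigma 1 x = T%:~R -> sigma 1 x != sigma 0 x ->
  sigma 1 x - sigma 0 x != f%:~R.
Proof.
move=> DT neq; apply/eqP => Df.
have x1 : sigma 1 x = ratr ((T + f)%:~R / 2).
  by rewrite rmorphM fmorphV /= ratr_int ratr_nat intrD -DT -Df; field.
have : sigma 1 (x - ((T + f)%:~R / 2)%:A) = 0.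
  by rewrite rmorphB x1 rmorph_scale_rat rmorph1 mulr1 subrr.
move/eqP; rewrite fmorph_eq0 subr_eq0 => /eqP Dx.
by move/eqP: neq; apply; rewrite Dx !rmorph_scale_rat !rmorph1.
Qed.

(** [D = T^2 - 4 N] is positive, not a square, and 0 or 1 modulo 4, so below 9 it is 5 or 8, that is
    [t^2 + 4] with [t] equal to 1 or 2. Translating [x] by an integer gives an element of trace [t]
    and norm -1, hence a unit [u]. Being a power of [eps] up to sign, it bounds the regulator by
    [ln g]. *)
Lemma quadratic_dichotomy :
  9 <= (\det (emb_mx sigma b)) ^+ 2 \/
  exists (t g : R), [/\ t = 1 \/ t = 2, (\det (emb_mx sigma b)) ^+ 2 = t ^+ 2 + 4,
    0 < g, g ^+ 2 = t * g + 1 &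
    expR `|ln `|sigma 0 (eps 0)| | <= g].
Proof.
have [x [T [N [xI DT DN neq DD]]]] := disc_quadratic.
have diff2 : (sigma 1 x - sigma 0 x) ^+ 2 = (T ^+ 2 - 4 * N)%:~R.
  by rewrite rmorphB rmorphXn rmorphM /= -DT -DN; ring.
rewrite DD; set D := T ^+ 2 - 4 * N in diff2 DD *.
have [D9|D9] := leP 9 D; [left | right].
  by rewrite (_ : 9 = 9%:~R) // ler_int.
have D0 : 0 < D.
  by rewrite -(ltr_int R) -diff2 exprn_even_gt0 //= subr_eq0.
have Dsq (f : int) : D != f ^+ 2.
  apply/eqP => Df; move: diff2; rewrite Df rmorphXn /= => /eqP.
  rewrite eqf_sqr => /orP[]; last rewrite -mulrNz.
    by rewrite (negPf (emb_diff_irrational _ DT neq)).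
  by rewrite (negPf (emb_diff_irrational _ DT neq)).
have [t [k [t12 Dt DTk]]] : exists t k : int,
    [/\ t = 1 \/ t = 2, D = t ^+ 2 + 4 & T - 2 * k = t].
  have := divz_eq T 2; set q := (T %/ 2)%Z; set r := (T %% 2)%Z => DTq.
  have r0 : 0 <= r by rewrite modz_ge0.
  have r2 : r < 2 by rewrite ltz_pmod.
  have : r = 0 \/ r = 1 by lia.
  case=> Dr; rewrite Dr in DTq.
    have DD4 : D = 4 * (q ^+ 2 - N) by rewrite /D DTq; ring.
    have : q ^+ 2 - N = 1 \/ q ^+ 2 - N = 2 by lia.
    case=> qN; first by have := Dsq 2; rewrite DD4 qN.
    by exists 2, (q - 1); split; [right | rewrite DD4 qN | rewrite DTq; ring].
  have DD4 : D = 4 * (q ^+ 2 + q - N) + 1 by rewrite /D DTq; ring.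
  have : q ^+ 2 + q - N = 0 \/ q ^+ 2 + q - N = 1 by lia.
  case=> qN; first by have := Dsq 1; rewrite DD4 qN.
  by exists 1, q; split; [left | rewrite DD4 qN | rewrite DTq; ring].
pose u := x - k%:~R.
have uI : is_integral u by apply: is_integralB => //; exact: is_integral_int.
have uE i : sigma i u = sigma i x - k%:~R by rewrite rmorphB rmorph_int.
have usum : sigma 0 u + sigma 1 u = t%:~R.
  by rewrite !uE -DTk rmorphB rmorphM /= -DT; ring.
have uprod : sigma 0 u * sigma 1 u = -1.
  have h : (sigma 1 u - sigma 0 u) ^+ 2 = t%:~R ^+ 2 + 4.
    by rewrite !uE -rmorphXn /= (_ : 4 = 4%:~R) // -intrD -Dt -diff2; ring.
  rewrite -usum in h.
  have : 4 * (sigma 0 u * sigma 1 u) = 4 * -1.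
    apply: (addIr ((sigma 1 u - sigma 0 u) ^+ 2)); rewrite {2}h; ring.
  by move/(mulfI (_ : 4 != 0 :> R)); apply.
have u0 : u != 0.
  by apply/eqP => u0; move/eqP: uprod; rewrite u0 rmorph0 mul0r eq_sym oppr_eq0 oner_eq0.
clearbody u; set v := sigma 0 u in usum uprod *.
have v2 : v ^+ 2 = t%:~R * v + 1 by rewrite -usum mulrDl [sigma 1 u * v]mulrC uprod; ring.
have uV : u^-1 = u - t%:~R.
  apply: (mulfI u0); rewrite mulfV //; apply: (fmorph_inj (sigma 0)).
  rewrite rmorph1 rmorphM rmorphB rmorph_int -/v.
  by rewrite mulrBr -expr2 v2; ring.
have uU : is_unitK u.
  split=> //; split=> //; rewrite uV; apply: is_integralB => //; exact: is_integral_int.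
have t0 : 0 < t%:~R :> R by rewrite ltr0z; case: t12 => ->.
have v0 : v != 0 by rewrite fmorph_eq0.
have [h [hv _]] := unit_log sigma_inj hb heps uU.
have {}hv : v ^+ 2 = expR ((h 0 0)%:~R * (2 * ln `|sigma 0 (eps 0)|)).
  rewrite /v; have <- : widen_ord (leqnSn 1) 0 = 0 :> 'I_2 by apply: val_inj.
  rewrite hv mxE big_ord1 !mxE; congr (expR (_ * (_ * ln `|sigma _ _|))).
(* The conjugate of [v] is [- 1/v]; [g] is the positive one of the two, [(1 + sqrt 5)/2] or
   [1 + sqrt 2]. *)
pose g := if 0 < v then v else - v^-1.
have gE : g ^+ 2 = t%:~R * g + 1.
  rewrite /g; case: ifP => // _.
  apply: (mulfI (expf_neq0 2 v0)).
  have -> : v ^+ 2 * (- v^-1) ^+ 2 = 1 by field.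
  have -> : v ^+ 2 * (t%:~R * - v^-1 + 1) = v ^+ 2 - t%:~R * v by field.
  by rewrite v2; ring.
have g0 : 0 < g.
  rewrite /g; case: ifPn => // ; rewrite -leNgt le_eqVlt (negPf v0) /= => vn.
  by rewrite oppr_gt0 invr_lt0.
exists t%:~R, g; split=> //; first by case: t12 => ->; [left | right].
  by rewrite -rmorphXn /= (_ : 4 = 4%:~R) // -intrD -Dt.
set l := ln _ in hv *.
have g1 : 1 < g.
  by rewrite ltNge; apply/negP => g1; have := mulr_gt0 t0 g0; nra.
pose s : R := (h 0 0)%:~R * (2 * l).
have gs : g ^+ 2 = expR `|s|.
  have g21 : 1 < g ^+ 2 by rewrite exprn_egt1.
  move: g21; rewrite /g; case: ifP => _.
    rewrite hv -/s => s1; rewrite ger0_norm //.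
    by move: s1; rewrite expR_gt1 => /ltW.
  rewrite sqrrN exprVn hv -/s -expRN => s1; rewrite ler0_norm //.
  by move: s1; rewrite expR_gt1 oppr_gt0 => /ltW.
have h0 : h 0 0 != 0.
  apply: contraTneq g1 => h0; rewrite -leNgt -(@expr_le1 _ 2) ?(ltW g0) //.
  by rewrite gs /s h0 mul0r normr0 expR0.
rewrite -(@ler_pXn2r _ 2) ?nnegrE ?expR_ge0 ?(ltW g0) //.
rewrite gs -expRM_natl ler_expR /s !normrM [`|2|]ger0_norm // ler_peMl ?mulr_ge0 //.
by rewrite -intr_norm ler1z -gtz0_ge1 normr_gt0.
Qed.

End QuadraticFields.

(** * Comparison of the constants *)

Section Numerics.
Variable R : realType.
Implicit Types (n m : nat) (x y : R).

Lemma gamma_half_gt0 n : 0 < gamma_half R n.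
Proof.
suff : 0 < gamma_half R n /\ 0 < gamma_half R n.+1 by case.
elim: n => [|n [IH1 IH2]].
  by split => //=; rewrite divr_gt0 // sqrtr_gt0 pi_gt0.
by split=> //=; rewrite mulr_gt0 // ltr_wpDl // divr_ge0.
Qed.

Definition ball_bound n : R := (n%:R * pi / 4) ^+ n / gamma_half R n ^+ 2.

Definition minkowski_const n : R := n%:R ^+ n / n`!%:R.

Lemma ball_bound_gt0 n : (0 < n)%N -> 0 < ball_bound n.
Proof.
move=> n0; rewrite divr_gt0 // exprn_gt0 ?gamma_half_gt0 //.
by rewrite divr_gt0 // mulr_gt0 ?pi_gt0 // ltr0n.
Qed.

Lemma minkowski_const_gt0 n : (0 < n)%N -> 0 < minkowski_const n.
Proof. by move=> n0; rewrite divr_gt0 ?exprn_gt0 // ltr0n // fact_gt0. Qed.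

Lemma ball_boundSS n : (0 < n)%N ->
  ball_bound n.+2 = ball_bound n * (n.+2%:R / n%:R) ^+ n * (pi ^+ 2 / 4).
Proof.
move=> n0; have nR : n%:R != 0 :> R by rewrite pnatr_eq0 -lt0n.
have g0 := lt0r_neq0 (gamma_half_gt0 n).
have n2 : n.+2%:R = n%:R + 2 :> R by rewrite -addn2 natrD.
have nR2 : n%:R + 2 != 0 :> R by rewrite -n2.
rewrite /ball_bound /= !exprS.
have -> : (n.+2%:R * pi / 4) ^+ n = (n%:R * pi / 4) ^+ n * (n.+2%:R / n%:R) ^+ n :> R.
  by rewrite -exprMn; congr (_ ^+ n); field.
rewrite expr0 n2; move: (_ ^+ n) (_ ^+ n) => u v; move: (gamma_half R n) g0 => g g0.
field.
by rewrite g0.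
Qed.

(** With [pi^2 <= 10] the recursion has a rational factor, so the bounds in degrees 4 to 7 follow
    from degrees 2 and 3. *)
Lemma ball_boundSS_le n c : (0 < n)%N -> ball_bound n <= c ->
  ball_bound n.+2 <= c * (n.+2%:R / n%:R) ^+ n * (5 / 2).
Proof.
move=> n0 Bc; rewrite ball_boundSS //.
have B0 := ltW (ball_bound_gt0 n0).
have e0 : 0 <= (n.+2%:R / n%:R) ^+ n :> R by rewrite exprn_ge0 // divr_ge0.
have p10 : pi ^+ 2 / 4 <= 5 / 2 :> R by have := pi_sqr_le10 R; lra.
apply: ler_pM => //; first exact: mulr_ge0.
  by rewrite divr_ge0 ?sqr_ge0.
exact: ler_wpM2r.
Qed.

Lemma ball_bound2 : ball_bound 2 <= 5 / 2.
Proof.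
rewrite /ball_bound /=.
have -> : (2 * pi / 4) ^+ 2 / ((0 / 2 + 1) * 1) ^+ 2 = pi ^+ 2 / 4 :> R by field.
by have := pi_sqr_le10 R; lra.
Qed.

Lemma ball_bound3 : ball_bound 3 <= 15 / 2.
Proof.
rewrite /ball_bound /=.
have s0 : 0 < Num.sqrt (pi : R) by rewrite sqrtr_gt0 pi_gt0.
have -> : (3 * pi / 4) ^+ 3 / ((1 / 2 + 1) * (Num.sqrt pi / 2)) ^+ 2 = 3 / 4 * pi ^+ 2 :> R.
  rewrite -[pi in LHS]sqr_sqrtr ?pi_ge0 // -[pi in RHS]sqr_sqrtr ?pi_ge0 //.
  rewrite sqrtr_sqr ger0_norm ?ltW //; field; exact: lt0r_neq0.
by have := pi_sqr_le10 R; lra.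
Qed.

Lemma ball_bound4 : ball_bound 4 <= 25.
Proof. by apply: le_trans (ball_boundSS_le _ ball_bound2) _ => //; lra. Qed.

Lemma ball_bound5 : ball_bound 5 <= 87.
Proof. by apply: le_trans (ball_boundSS_le _ ball_bound3) _ => //; lra. Qed.

Lemma ball_bound6 : ball_bound 6 <= 317.
Proof. by apply: le_trans (ball_boundSS_le _ ball_bound4) _ => //; lra. Qed.

Lemma ball_bound7 : ball_bound 7 <= 1170.
Proof. by apply: le_trans (ball_boundSS_le _ ball_bound5) _ => //; lra. Qed.

Lemma expR1_le3 : expR 1 <= 3 :> R.
Proof.
have h : expR (- (1 / 8)) >= 7 / 8 :> R.
  by apply: le_trans (expR_ge1Dx _); lra.
rewrite (_ : expR 1 = expR (8%:R * (1 / 8))); last by congr expR; field.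
rewrite expRM_natl -[expR _]invrK -expRN.
have : (expR (- (1 / 8)))^-1 <= 8 / 7 :> R.
  by rewrite -[8 / 7]invf_div lef_pV2 ?posrE ?expR_gt0 //; lra.
have : 0 <= (expR (- (1 / 8)))^-1 :> R by rewrite invr_ge0 expR_ge0.
move: (_^-1) => z z0 z1.
apply: le_trans (_ : (8 / 7) ^+ 8 <= _); last by lra.
by rewrite lerXn2r ?nnegrE //; lra.
Qed.

Lemma expn_succ_ratio n : (0 < n)%N -> (n.+1%:R / n%:R) ^+ n <= 3 :> R.
Proof.
move=> n0; apply: le_trans expR1_le3.
have nR : n%:R != 0 :> R by rewrite pnatr_eq0 -lt0n.
rewrite -[X in expR X](mulfV nR) expRM_natl lerXn2r ?nnegrE ?expR_ge0 ?divr_ge0 //.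
by rewrite -natr1 mulrDl mulfV // mul1r expR_ge1Dx.
Qed.

Lemma minkowski_constS n : (0 < n)%N ->
  minkowski_const n.+1 = minkowski_const n * (n.+1%:R / n%:R) ^+ n.
Proof.
move=> n0; have nR : n%:R != 0 :> R by rewrite pnatr_eq0 -lt0n.
have f0 : n`!%:R != 0 :> R by rewrite pnatr_eq0 -lt0n fact_gt0.
rewrite /minkowski_const factS natrM exprS expr_div_n.
have n1 : n.+1%:R != 0 :> R by rewrite pnatr_eq0.
have := expf_neq0 n nR; move: (n%:R ^+ n) (n.+1%:R) n1 (n`!%:R) f0 => u a a0 f f0 u0.
by field; apply/and3P.
Qed.

Lemma minkowski_const_le n : (0 < n)%N -> minkowski_const n <= 3 ^+ n.-1.
Proof.
elim: n => // [[|n]] IHn _; first by rewrite /minkowski_const expr1 divr1.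
rewrite minkowski_constS // -[n.+2.-1]/(n.+1) [leRHS]exprSr; apply: ler_pM.
- exact/ltW/minkowski_const_gt0.
- by rewrite exprn_ge0 // divr_ge0.
- exact: IHn.
- exact: expn_succ_ratio.
Qed.


Lemma minkowski_constSS n : (0 < n)%N ->
  minkowski_const n.+2 =
  minkowski_const n * (n.+2%:R / n%:R) ^+ n * (n.+2%:R / n.+1%:R).
Proof.
move=> n0; have nR : n%:R != 0 :> R by rewrite pnatr_eq0 -lt0n.
have f0 : n`!%:R != 0 :> R by rewrite pnatr_eq0 -lt0n fact_gt0.
have n1 : n.+1%:R != 0 :> R by rewrite pnatr_eq0.
have n2 : n.+2%:R != 0 :> R by rewrite pnatr_eq0.
rewrite /minkowski_const !factS !natrM !exprS expr_div_n.
have := expf_neq0 n nR; move: (n%:R ^+ n : R) (n.+2%:R ^+ n : R) => u v u0.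
move: (n.+1%:R : R) n1 (n`!%:R : R) f0 (n.+2%:R : R) n2 => a a0 f f0 b b0.
by field; rewrite f0 u0 a0 b0.
Qed.

Lemma binomial2_le x n : 0 <= x ->
  1 + n%:R * x + n%:R * (n%:R - 1) / 2 * x ^+ 2 <= (1 + x) ^+ n.
Proof.
move=> x0; elim: n => [|n IHn]; first by rewrite !mul0r !addr0 expr0.
rewrite [leRHS]exprS; apply: le_trans (ler_wpM2l _ IHn); last by rewrite addr_ge0.
rewrite -natr1; set k : R := n%:R.
have k1 : 0 <= k * (k - 1).
  by rewrite /k; case: (n) => [|p]; rewrite ?mul0r // -natr1 addrK mulr_ge0 // addr_ge0.
have : 0 <= k * (k - 1) * x ^+ 3 by rewrite mulr_ge0 // exprn_ge0.
by clearbody k; nra.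
Qed.

Lemma ratio_SS_ge n : (4 <= n)%N -> 9 / 2 <= (n.+2%:R / n%:R) ^+ n :> R.
Proof.
move=> n4; have n4R : 4 <= n%:R :> R by rewrite ler_nat.
have nR : n%:R != 0 :> R by rewrite gt_eqF //; lra.
have -> : n.+2%:R / n%:R = 1 + 2 / n%:R :> R by rewrite -addn2 natrD; field.
apply: le_trans (binomial2_le _ _); last by rewrite divr_ge0.
move: (n%:R : R) n4R nR => k k4 k0.
have -> : 1 + k * (2 / k) + k * (k - 1) / 2 * (2 / k) ^+ 2 = 5 - 2 / k by field.
have : 2 / k <= 1 / 2 by rewrite ler_pdivrMr; lra.
by lra.
Qed.

Definition minkowski_quot n : R := minkowski_const n ^+ 2 / ball_bound n.

Lemma minkowski_quotSS n : (4 <= n)%N -> 4 / 3 * minkowski_quot n <= minkowski_quot n.+2.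
Proof.
move=> n4; have n0 : (0 < n)%N by apply: leq_trans n4.
rewrite /minkowski_quot ball_boundSS // minkowski_constSS //.
have := ratio_SS_ge n4; set e := (_ / _) ^+ n => e92.
have := ball_bound_gt0 n0; have := minkowski_const_gt0 n0.
move: (minkowski_const n) (ball_bound n) => a c a0 c0.
have r1 : 1 <= (n.+2%:R / n.+1%:R : R).
  by rewrite ler_pdivlMr // mul1r ler_nat.
move: (_ / _ : R) r1 => r r1.
have p0 := pi_gt0 R; have p10 := pi_sqr_le10 R.
have -> : (a * e * r) ^+ 2 / (c * e * (pi ^+ 2 / 4)) = a ^+ 2 / c * (e * r ^+ 2 * (4 / pi ^+ 2)).
  by field; rewrite !gt_eqF //; lra.
rewrite mulrC ler_pM2l ?divr_gt0 ?exprn_gt0 //.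
have h1 : 2 / 5 <= 4 / pi ^+ 2 :> R by rewrite ler_pdivlMr ?exprn_gt0 //; lra.
have h2 : 1 <= r ^+ 2 by rewrite exprn_ege1.
have h3 : 9 / 2 <= e * r ^+ 2 by nra.
by move: (e * _) (4 / _) h3 h1 => u v; nra.
Qed.

Lemma minkowski_quot_ge n (a c : R) : (0 < n)%N -> 0 <= a ->
  a <= minkowski_const n -> ball_bound n <= c -> a ^+ 2 / c <= minkowski_quot n.
Proof.
move=> n0 a0 ale cge; have B0 := ball_bound_gt0 n0.
rewrite /minkowski_quot ler_pM ?sqr_ge0 ?invr_ge0 ?(le_trans (ltW B0)) //.
  by rewrite lerXn2r ?nnegrE // (le_trans a0).
by rewrite lef_pV2 ?posrE // (lt_le_trans B0).
Qed.

(* The threshold [exp x >= 2 (minkowski_quot n - 1)] below which Minkowski's bound suffices. *)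
Definition threshold n : R := 2 * (minkowski_quot n - 1).

(** The induction goes by steps of two: [minkowski_quotSS] makes the threshold grow by at least 4/3,
    its square by [(4/3)^2], as the left side does. The constant is [81 = 3^4] because
    [minkowski_const] enters [threshold_large] to the fourth power and is at most [3^m] in degree
    [m + 1]. *)
Lemma threshold_sqr n : (6 <= n)%N ->
  0 < threshold n /\ 81 * (4 / 3) ^+ n < threshold n ^+ 2.
Proof.
suff H k : [/\ 0 < threshold k.+4.+2, 81 * (4 / 3) ^+ k.+4.+2 < threshold k.+4.+2 ^+ 2,
    0 < threshold k.+4.+3 & 81 * (4 / 3) ^+ k.+4.+3 < threshold k.+4.+3 ^+ 2].
  by move=> n6; rewrite -(subnK n6) addnC; case: (H (n - 6)%N).
elim: k => [|k [IH1 IH2 IH3 IH4]].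
  have q6 : 12 <= minkowski_quot 6.
    apply: le_trans (minkowski_quot_ge (a := 64) _ _ _ ball_bound6) => //; try lra.
    by rewrite /minkowski_const (_ : 6`! = 720)%N // ler_pdivlMr ?ltr0n //; lra.
  have q7 : 22 <= minkowski_quot 7.
    apply: le_trans (minkowski_quot_ge (a := 163) _ _ _ ball_bound7) => //; try lra.
    by rewrite /minkowski_const (_ : 7`! = 5040)%N // ler_pdivlMr ?ltr0n //; lra.
  split; rewrite /threshold; try lra.
    apply: lt_le_trans (_ : 22 ^+ 2 <= _); first by lra.
    by rewrite lerXn2r ?nnegrE //; lra.
  apply: lt_le_trans (_ : 42 ^+ 2 <= _); first by lra.
  by rewrite lerXn2r ?nnegrE //; lra.
split=> //.
  have := @minkowski_quotSS k.+4.+2 isT; rewrite /threshold in IH1 *; lra.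
have h : 4 / 3 * threshold k.+4.+2 <= threshold k.+4.+4.
  by have := @minkowski_quotSS k.+4.+2 isT; rewrite /threshold in IH1 *; lra.
apply: lt_le_trans (_ : (4 / 3 * threshold k.+4.+2) ^+ 2 <= _); last first.
  have h0 : 0 <= 4 / 3 * threshold k.+4.+2 by apply: mulr_ge0; lra.
  by rewrite lerXn2r ?nnegrE // (le_trans h0).
rewrite [(_ * threshold _) ^+ 2]exprMn [(4 / 3) ^+ k.+4.+4]exprS [(4 / 3) ^+ k.+4.+3]exprS.
by move: ((4 / 3) ^+ k.+4.+2) (threshold _ ^+ 2) IH2 => u v; lra.
Qed.

(** From degree 6 on this is the [m]-th power of [threshold_sqr]. Degree 5 does not satisfy that
    inequality and is settled with [minkowski_const 5 <= 27]. *)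
Lemma threshold_large m : (4 <= m)%N -> 1 < threshold m.+1 /\
  (4 / 3) ^+ (m.+1 * m) * (minkowski_const m.+1 ^+ 2) ^+ 2 < threshold m.+1 ^+ (2 * m).
Proof.
rewrite leq_eqVlt => /predU1P[<-|m5].
  have q5 : 7 + 7 / 10 <= minkowski_quot 5.
    apply: le_trans (minkowski_quot_ge (a := 26) _ _ _ ball_bound5) => //; try lra.
    by rewrite /minkowski_const (_ : 5`! = 120)%N // ler_pdivlMr ?ltr0n //; lra.
  have m5 : minkowski_const 5 <= 27.
    by rewrite /minkowski_const (_ : 5`! = 120)%N // ler_pdivrMr ?ltr0n //; lra.
  have m50 := @minkowski_const_gt0 5 isT.
  split; first by rewrite /threshold; lra.
  apply: le_lt_trans (_ : (4 / 3) ^+ 20 * (27 ^+ 2) ^+ 2 < _).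
    by rewrite ler_wpM2l ?exprn_ge0 // !lerXn2r ?nnegrE ?exprn_ge0 ?sqr_ge0 ?(ltW m50).
  apply: lt_le_trans (_ : (134 / 10) ^+ 8 <= _); first by lra.
  by rewrite lerXn2r ?nnegrE /threshold //; lra.
have [t0 t81] := @threshold_sqr m.+1 m5; split.
  have : 1 <= (4 / 3) ^+ m.+1 :> R by apply: exprn_ege1; lra.
  by move: (_ ^+ m.+1) t81 => u t81 u1; rewrite ltNge; apply/negP => t1; nra.
have a_le := @minkowski_const_le m.+1 isT.
have a0 := ltW (@minkowski_const_gt0 m.+1 isT).
apply: le_lt_trans (_ : (81 * (4 / 3) ^+ m.+1) ^+ m < _).
  rewrite [leRHS]exprMn exprM mulrC ler_wpM2r ?exprn_ge0 //.
  have -> : 81 ^+ m = ((3 ^+ m) ^+ 2) ^+ 2 :> R.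
    rewrite (_ : 81 = 3 ^+ 4); last by lra.
    by rewrite -!exprM; congr (_ ^+ _); lia.
  by rewrite !lerXn2r ?nnegrE ?exprn_ge0 ?sqr_ge0.
have m0 : (0 < m)%N by apply: leq_trans m5.
rewrite exprM ltr_pXn2r ?nnegrE ?sqr_ge0 // mulr_ge0 // exprn_ge0 //; lra.
Qed.

(** Allows [kappa = m]. It amounts to [minkowski_const m ^ 2 < (m + 1)^m], and
    [9^(m - 1) < (m + 1)^m] suffices; the latter fails at [m = 4], which is computed directly. *)
Lemma covering_constant m : (4 <= m)%N ->
  m%:R ^+ (2 * m) < m`!%:R ^+ 2 * m.+1%:R ^+ m :> R.
Proof.
move=> m4; have m0 : (0 < m)%N by apply: leq_trans m4.
have f0 : 0 < m`!%:R :> R by rewrite ltr0n fact_gt0.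
have -> : m%:R ^+ (2 * m) = (m`!%:R * minkowski_const m) ^+ 2.
  by rewrite /minkowski_const mulrC divfK ?gt_eqF // -exprM mulnC.
rewrite exprMn ltr_pM2l ?exprn_gt0 //.
move: m4; rewrite leq_eqVlt => /predU1P[<-|m5].
  by rewrite /minkowski_const (_ : 4`! = 24)%N //; lra.
have a_le := minkowski_const_le m0.
have a0 := ltW (minkowski_const_gt0 m0).
apply: le_lt_trans (_ : (3 ^+ m.-1) ^+ 2 < _).
  by rewrite lerXn2r ?nnegrE ?exprn_ge0.
rewrite -exprM mulnC exprM (_ : 3 ^+ 2 = 9%:R :> R); last by lra.
move: m5; rewrite leq_eqVlt => /predU1P[<-|m6]; first by rewrite -[5.-1]/4%N; lra.
move: m6; rewrite leq_eqVlt => /predU1P[<-|m7]; first by rewrite -[6.-1]/5%N; lra.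
move: m7; rewrite leq_eqVlt => /predU1P[<-|m8]; first by rewrite -[7.-1]/6%N; lra.
rewrite -!natrX ltr_nat.
case: m m8 {m0 f0 a_le a0} => // m m8 /=.
apply: (@leq_trans (9 ^ m.+1)); first by rewrite ltn_exp2l.
by rewrite leq_exp2r // ltnW.
Qed.

End Numerics.

(** * Incompatible bounds on the discriminant, degree by degree *)

Section FinalNumerics.
Variable R : realType.
Implicit Types (D : R).

Lemma exprn_le (x y : R) n : 0 <= x -> x <= y -> x ^+ n <= y ^+ n.
Proof. by move=> x0 xy; rewrite lerXn2r ?nnegrE // (le_trans x0). Qed.

Lemma exprn_lt (x y : R) n : (0 < n)%N -> 0 <= x -> x < y -> x ^+ n < y ^+ n.
Proof. by move=> n0 x0 xy; rewrite ltr_pXn2r ?nnegrE // (le_trans x0) // ltW. Qed.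

(** Here [k = e^(x/10)], so that [kappa = 7/5], just below the limit [sqrt 2], gives [e^r = k^7].
    The value 26/5 is what [9 <= D] implies for [e^x]. Both terms of the trace bound are kept: their
    cross term 2 is needed. *)
Lemma degree2_contra (k D : R) : 0 < k -> 26 / 5 <= k ^+ 10 ->
  D <= 5 / 2 * (1 + k ^+ 10 / 2) ->
  (k ^+ 7 + (k ^+ 7)^-1) ^+ 2 <= 4 / 3 * D -> False.
Proof.
move=> k0 k10 Dle; have k7 : 0 < k ^+ 7 by rewrite exprn_gt0.
have -> : (k ^+ 7 + (k ^+ 7)^-1) ^+ 2 = k ^+ 10 * k ^+ 4 + 2 + ((k ^+ 7)^-1) ^+ 2.
  by field; rewrite gt_eqF.
have i0 : 0 <= ((k ^+ 7)^-1) ^+ 2 by rewrite sqr_ge0.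
have k4 : 193 / 100 <= k ^+ 4.
  rewrite leNgt; apply/negP => k4.
  have : (k ^+ 4) ^+ 5 < (193 / 100) ^+ 5.
    exact: exprn_lt (exprn_ge0 4 (ltW k0)) k4.
  have -> : (k ^+ 4) ^+ 5 = (k ^+ 10) ^+ 2 by rewrite -!exprM.
  by move: (k ^+ 10) k10 => K k10 h; nra.
by move: (k ^+ 10) (k ^+ 4) (_ ^-1 ^+ 2) k10 k4 Dle i0 => K u v *; nra.
Qed.

Lemma degree3_contra (w D : R) : 0 < w -> 81 / 4 <= D ->
  D <= 15 / 2 * (1 + w ^+ 5 / 2) ->
  (w ^+ 4 + 2 * w ^- 2) ^+ 3 <= (4 / 3) ^+ 3 * D -> False.
Proof.
move=> w0 D20 Dle.
have w5 : 17 / 5 <= w ^+ 5 by lra.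
have w2 : 163 / 100 <= w ^+ 2.
  rewrite leNgt; apply/negP => w2.
  have : (w ^+ 2) ^+ 5 < (163 / 100) ^+ 5.
    exact: exprn_lt (exprn_ge0 2 (ltW w0)) w2.
  have -> : (w ^+ 2) ^+ 5 = (w ^+ 5) ^+ 2 by rewrite -!exprM.
  by move: (w ^+ 5) w5 => K k10 h; nra.
have w1 : 127 / 100 <= w by nra.
have -> : (w ^+ 4 + 2 * w ^- 2) ^+ 3 =
    w ^+ 5 * (w ^+ 5 * w ^+ 2) + 6 * (w * w ^+ 5) + 12 + 8 * (w ^- 2) ^+ 3.
  by field; rewrite gt_eqF.
have i0 : 0 <= (w ^- 2) ^+ 3 by rewrite exprn_ge0 // invr_ge0 sqr_ge0.
move: (w ^+ 5) (w ^+ 2) (_ ^+ 3) w5 w2 Dle i0 => W V U w5 w2 Dle i0 h.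
have h1 : 17 / 5 * (163 / 100) <= W * V by apply: ler_pM; lra.
have h2 : 17 / 5 * (163 / 100) * W <= W * (W * V) by rewrite mulrC ler_pM2l //; lra.
have h3 : 127 / 100 * W <= w * W by rewrite ler_pM2r //; lra.
by lra.
Qed.

(** With [z = e^(x/2)] and [kappa = 7/2], [z^7] is [e^(4 r)]; the leading exponential alone
    suffices. *)
Lemma degree4_contra (z D : R) : 0 < z -> 1024 / 9 <= D ->
  D <= 25 * (1 + z ^+ 2 / 2) -> z ^+ 7 <= (4 / 3) ^+ 6 * D -> False.
Proof.
move=> z0 D113 Dle.
have z2 : 71 / 10 <= z ^+ 2 by lra.
have z1 : 133 / 50 <= z by nra.
have z5 : (133 / 50) ^+ 5 <= z ^+ 5.
  exact: exprn_le (divr_ge0 (ler0n R 133) (ler0n R 50)) z1.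
have -> : z ^+ 7 = z ^+ 2 * z ^+ 5 by rewrite -exprD.
move: (z ^+ 2) (z ^+ 5) z2 z5 Dle => u v z2 z5 Dle h.
have : u * 133 <= u * v by rewrite ler_pM2l; lra.
by lra.
Qed.

(** Minkowski's bound forces [y >= t], the threshold. Since [(1 + y/2) / y] decreases, [D / y] is at
    most [a^2 / t], and the contradiction reduces to the case [y = t], which is
    [threshold_large]. *)
Lemma large_degree_contra m (y D : R) : (4 <= m)%N -> 0 < y ->
  minkowski_const R m.+1 ^+ 2 <= D -> D <= ball_bound R m.+1 * (1 + y / 2) ->
  y ^+ (2 * m) <= (4 / 3) ^+ (m.+1 * m) * D ^+ 2 -> False.
Proof.
move=> m4 y0 aD Dc yD.
have m2 : (2 * m = 2 * m.-1 + 2)%N by case: (m) m4 => // p _; rewrite mulnS addnC.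
have [t1 tF] := threshold_large R m4.
set t := threshold R m.+1 in t1 tF; set a := minkowski_const R m.+1 in aD tF.
have c0 := ball_bound_gt0 R (ltn0Sn m).
have t0 : 0 < t by apply: lt_trans t1.
set c := ball_bound R m.+1 in Dc c0.
have qc : a ^+ 2 = c * (1 + t / 2).
  by rewrite /t /threshold /minkowski_quot -/a -/c; field; rewrite gt_eqF.
clearbody t a c.
have ty : t <= y.
  have := le_trans aD Dc; rewrite qc ler_pM2l //; lra.
have Dt : D * t <= a ^+ 2 * y.
  apply: le_trans (_ : c * (1 + y / 2) * t <= _); first by rewrite ler_pM2r.
  by rewrite qc -[c * _ * t]mulrA -[c * _ * y]mulrA ler_pM2l //; lra.
have a0 : 0 <= a ^+ 2 by rewrite sqr_ge0.
have D0 : 0 <= D by apply: le_trans aD.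
set F := (4 / 3) ^+ _ in tF yD.
have F0 : 0 <= F by rewrite exprn_ge0.
have Dt2 : D ^+ 2 * t ^+ 2 <= (a ^+ 2) ^+ 2 * y ^+ 2.
  have Dt0 : 0 <= D * t by rewrite mulr_ge0 // ltW.
  by rewrite -[leLHS]exprMn -[leRHS]exprMn lerXn2r ?nnegrE // (le_trans Dt0).
rewrite m2 exprD in tF; rewrite m2 exprD in yD.
have y2 : 0 < y ^+ 2 by rewrite exprn_gt0.
have : y ^+ (2 * m.-1) * t ^+ 2 <= F * (a ^+ 2) ^+ 2.
  rewrite -(ler_pM2r y2); apply: le_trans (_ : F * D ^+ 2 * t ^+ 2 <= _).
    by rewrite [leLHS]mulrAC; apply: ler_wpM2r; rewrite ?sqr_ge0.
  by rewrite -mulrA -[leRHS]mulrA ler_wpM2l.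
apply/negP; rewrite -ltNge; apply: lt_le_trans tF _.
rewrite ler_wpM2r ?sqr_ge0 // lerXn2r ?nnegrE ?(ltW t0) ?(ltW y0) //.
Qed.

(** In degree 2, [x = sqrt 2 r], so [e^x] is at most [g^(sqrt 2)]. The exponent is replaced by the
    upper approximations 17/12 for discriminant 5 and 3/2 for discriminant 8. *)
Lemma golden_contra (t g x r : R) : t = 1 \/ t = 2 -> 0 < g -> g ^+ 2 = t * g + 1 ->
  expR r <= g -> 0 <= r -> x ^+ 2 = 2 * r ^+ 2 -> 0 <= x ->
  t ^+ 2 + 4 <= 5 / 2 * (1 + expR x / 2) -> False.
Proof.
move=> t12 g0 g2 rg r0 x2 x0 Dle.
have e0 := expR_gt0 r.
have y0 := expR_gt0 x.
have x_le (p q : nat) : (0 < q)%N -> (2 * q ^ 2 <= p ^ 2)%N -> expR x ^+ q <= g ^+ p.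
  move=> q0 qp; apply: le_trans (_ : expR r ^+ p <= _); last first.
    by rewrite lerXn2r ?nnegrE ?(ltW e0) ?(ltW g0).
  rewrite -!expRM_natl ler_expR -(@ler_pXn2r _ 2) ?nnegrE ?mulr_ge0 //.
  rewrite !exprMn x2 mulrCA mulrA ler_wpM2r ?sqr_ge0 //.
  by rewrite -!natrX -natrM ler_nat.
case: t12 g2 Dle => -> g2 Dle.
  have g1 : g <= 13 / 8 by nra.
  have y2 : 2 <= expR x by lra.
  have : expR x ^+ 12 <= g ^+ 17 by apply: x_le.
  apply/negP; rewrite -ltNge.
  apply: lt_le_trans (_ : 2 ^+ 12 <= _); last exact: exprn_le (ler0n R 2) y2.
  apply: le_lt_trans (_ : (13 / 8) ^+ 17 < _); last by lra.
  exact: exprn_le (ltW g0) g1.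
have g1 : g <= 5 / 2 by nra.
have y2 : 22 / 5 <= expR x by lra.
have : expR x ^+ 2 <= g ^+ 3 by apply: x_le.
apply/negP; rewrite -ltNge.
apply: lt_le_trans (_ : (22 / 5) ^+ 2 <= _); last exact: exprn_le (divr_ge0 (ler0n R 22) (ler0n R 5)) y2.
apply: le_lt_trans (_ : (5 / 2) ^+ 3 < _); last by lra.
exact: exprn_le (ltW g0) g1.
Qed.

End FinalNumerics.

(** * The bound in terms of the regulator *)

Section Regulator.
Variables (R : realType) (L : fieldExtType rat) (m : nat).
Variables (sigma : 'I_m.+1 -> {rmorphism L -> R}) (b : 'I_m.+1 -> L) (eps : 'I_m -> L).
Hypotheses (sigma_inj : real_embeddings sigma) (hb : integral_basis b).
Hypotheses (heps : fundamental_units eps) (Dn : \dim {:L} = m.+1).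
Hypotheses (hTR : totally_real L) (redL : unit_reducible L) (m0 : (0 < m)%N).

Definition reg_exponent : R := 2 / Num.sqrt m.+1%:R *
  regulator_of sigma (eps : 'I_m.+1.-1 -> L) `^ (m%:R)^-1.

Lemma reg_exponent_ge0 : 0 <= reg_exponent.
Proof. by rewrite mulr_ge0 ?powR_ge0 // divr_ge0 ?sqrtr_ge0. Qed.

Lemma reg_exponent_sqr : (reg_exponent ^+ m) ^+ 2 * m.+1%:R ^+ m =
  (2 ^+ m * regulator_of sigma (eps : 'I_m.+1.-1 -> L)) ^+ 2.
Proof.
have reg0 : 0 <= regulator_of sigma (eps : 'I_m.+1.-1 -> L) by exact: normr_ge0.
have -> : (reg_exponent ^+ m) ^+ 2 * m.+1%:R ^+ m =
    ((reg_exponent ^+ 2 * m.+1%:R) ^+ m) by rewrite [RHS]exprMn -!exprM mulnC.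
have -> : reg_exponent ^+ 2 * m.+1%:R =
    (2 * regulator_of sigma (eps : 'I_m.+1.-1 -> L) `^ (m%:R)^-1) ^+ 2.
  rewrite /reg_exponent -{2}[m.+1%:R]sqr_sqrtr // -exprMn mulrAC divfK //.
rewrite -exprM mulnC exprM exprMn -[_ `^ _ ^+ m]powR_mulrn ?powR_ge0 //.
by rewrite -powRrM mulVf ?powRr1 // pnatr_eq0 -lt0n.
Qed.

(** With this [r] the power of the regulator cancels from the covering condition by
    [reg_exponent_sqr], leaving a numerical condition on [kappa]; the slack [d] is then sent to
    0. *)
Lemma unit_reducible_bound (kappa r : R) : 0 <= kappa -> 0 < reg_exponent ->
  kappa ^+ (2 * m) < m`!%:R ^+ 2 * m.+1%:R ^+ m ->
  r = kappa * reg_exponent / m.+1%:R ->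
  (expR r + m%:R * expR (- (r / m%:R))) ^+ m.+1 <=
  (4 / 3) ^+ 'C(m.+1, 2) * ratr (disc_of_basis b).
Proof.
move=> k0 x0 km Dr; have r0 : 0 <= r by rewrite Dr divr_ge0 // mulr_ge0 // ltW.
have n1 : m.+1%:R != 0 :> R by rewrite pnatr_eq0.
have S0 : 0 < expR r + m%:R * expR (- (r / m%:R)).
  by rewrite ltr_pwDl ?expR_gt0 // mulr_ge0 ?expR_ge0.
apply: (@le_of_le_expR _ (4 * m.+1 + 'C(m.+1, 2))%:R) => // [|d d0].
  by rewrite (disc_emb b Dn sigma_inj) mulr_ge0 ?sqr_ge0 ?exprn_ge0 ?divr_ge0.
apply: (unit_reducible_hermite sigma_inj hb heps) => //.
have -> : m.+1%:R * r = kappa * reg_exponent by rewrite Dr mulrC divfK.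
have := reg_exponent_sqr.
set rg := regulator_of _ _; have rg0 : 0 <= rg by exact: normr_ge0.
move: reg_exponent x0 {Dr} => x x0 xsqr.
have f0 : 0 < m`!%:R :> R by rewrite ltr0n fact_gt0.
have kx0 : 0 <= kappa * x by rewrite mulr_ge0 // ltW.
have mrg0 : 0 <= m`!%:R * (2 ^+ m * rg) by rewrite !mulr_ge0 ?exprn_ge0 // ltW.
rewrite -(@ltr_pXn2r _ 2) ?nnegrE ?exprn_ge0 // [X in _ < X]exprMn -xsqr.
rewrite [X in _ < X]mulrCA.
have -> : ((kappa * x) ^+ m) ^+ 2 = (x ^+ m) ^+ 2 * kappa ^+ (2 * m).
  by rewrite [(kappa * _) ^+ m]exprMn [LHS]exprMn mulrC -[(kappa ^+ m) ^+ 2]exprM [(m * 2)%N]mulnC.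
by rewrite ltr_pM2l ?exprn_gt0.
Qed.

End Regulator.

Lemma bin2_mul2 m : (2 * 'C(m.+1, 2) = m.+1 * m)%N.
Proof. by rewrite -mul_bin_diag bin1. Qed.

Theorem theorem6 (R : realType) (L : fieldExtType rat) (n : nat)
  (hn : \dim {:L} = n) (h2 : (2 <= n)%N)
  (hTR : totally_real L)
  (sigma : 'I_n -> {rmorphism L -> R}) (hsigma : real_embeddings sigma)
  (b : 'I_n -> L) (hb : integral_basis b)
  (eps : 'I_n.-1 -> L) (heps : fundamental_units eps) :
  `| ratr (disc_of_basis b) : R | /
     (1 + 2^-1 * expR (2 / Num.sqrt (n%:R) *
                       powR (regulator_of sigma eps) (n.-1)%:R^-1))
   <= (n%:R * pi / 4) ^+ n / (Gamma (n%:R / 2 + 1)) ^+ 2 ->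
  ~ unit_reducible L.
Proof.
case: n hn h2 sigma hsigma b hb eps heps => // m Dn m0 sigma hsigma b hb eps heps.
rewrite -/(reg_exponent sigma eps) GammaE -/(ball_bound R m.+1) => le_ball redL.
pose D : R := ratr (disc_of_basis b).
have DE : D = (\det (emb_mx sigma b)) ^+ 2 by exact: disc_emb.
have aD : minkowski_const R m.+1 ^+ 2 <= D.
  rewrite /minkowski_const expr_div_n ler_pdivrMr ?exprn_gt0 ?ltr0n ?fact_gt0 //.
  by rewrite [leRHS]mulrC; apply: (minkowski_disc_bound Dn hsigma hb).
have red kappa r := @unit_reducible_bound R L m sigma b eps hsigma hb heps Dn hTR redL m0 kappa r.
have x0 := reg_exponent_ge0 sigma eps.
have xE := reg_exponent_sqr sigma eps m0.
rewrite -/D in red le_ball.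
move: (reg_exponent sigma eps) le_ball red x0 xE => x le_ball red x0 xE.
have W0 : 0 < 1 + expR x / 2 by rewrite addr_gt0 // divr_gt0 ?expR_gt0.
(* The hypothesis, in the form linear in [e^x] used in every degree. *)
have D_le c : ball_bound R m.+1 <= c -> D <= c * (1 + expR x / 2).
  move=> Bc; apply: le_trans (_ : ball_bound R m.+1 * (1 + expR x / 2) <= _).
    move: le_ball; rewrite [2^-1 * _]mulrC ler_pdivrMr // ger0_norm //.
    by rewrite DE sqr_ge0.
  by rewrite ler_pM2r.
have x_pos : 1 < expR x -> 0 < x by rewrite expR_gt1.
have [m4|m4] := leqP 4 m.
  have [t1 _] := threshold_large R m4.
  have B0 := ball_bound_gt0 R (ltn0Sn m).
  have xp : 0 < x.
    apply: x_pos; apply: lt_le_trans t1 _; rewrite /threshold /minkowski_quot.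
    have : minkowski_const R m.+1 ^+ 2 / ball_bound R m.+1 <= 1 + expR x / 2.
      by rewrite ler_pdivrMr // mulrC (le_trans aD) // D_le.
    by move: (_ / ball_bound R _) => q; lra.
  apply: (large_degree_contra m4 (expR_gt0 x) aD (D_le _ (lexx _))).
  have := red m%:R _ (ler0n _ _) xp (covering_constant R m4) erefl.
  set S := expR _ + _ => leS.
  (* Here [n r = m x], so the leading exponential of [S] alone gives [e^(m x)]. *)
  have Sx : expR x ^+ m <= S ^+ m.+1.
    apply: le_trans (_ : expR (m%:R * x / m.+1%:R) ^+ m.+1 <= _).
      by rewrite -!expRM_natl ler_expR [leRHS]mulrC divfK // pnatr_eq0.
    by apply: exprn_le; rewrite ?expR_ge0 // lerDl mulr_ge0 ?expR_ge0.
  have := exprn_le 2 (exprn_ge0 m (expR_ge0 x)) (le_trans Sx leS).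
  by rewrite -exprM exprMn -!exprM [(m * 2)%N]mulnC -bin2_mul2 [(2 * 'C(_, _))%N]mulnC.
have : m = 1%N \/ m = 2%N \/ m = 3%N by case: (m) m0 m4 => [|[|[|[|]]]] //; auto.
case=> [|[]] Dm; subst m.
- have D5 := D_le _ (ball_bound2 R).
  have rE : regulator_of sigma eps = `|ln `|sigma 0 (eps 0)| |.
    rewrite /regulator_of det_mx11 !mxE; congr (`|ln `|sigma _ _| |); exact: val_inj.
  rewrite !expr1 rE in xE.
  have xr : x ^+ 2 = 2 * `|ln `|sigma 0 (eps 0)| | ^+ 2.
    by move: xE; rewrite exprMn => h; lra.
  (* Minkowski's bound only gives [D >= 4] in degree 2, too little for the Hermite estimate; this is
     why 5 and 8 are set apart. *)
  have [D9|[t [g [t12 Dt g0 g2 rg]]]] := quadratic_dichotomy hsigma hb heps; last first.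
    rewrite -DE in Dt; rewrite Dt in D5.
    exact: (golden_contra t12 g0 g2 rg (normr_ge0 _) xr x0 D5).
  rewrite -DE in D9.
  have y5 : 26 / 5 <= expR x by lra.
  have xp : 0 < x by apply: x_pos; lra.
  pose k := expR (x / 10).
  have k10 : expR x = k ^+ 10 by rewrite -expRM_natl; congr expR; field.
  have k7 : expR (7 / 5 * x / 2) = k ^+ 7 by rewrite -expRM_natl; congr expR; field.
  rewrite k10 in y5 D5.
  apply: (degree2_contra (expR_gt0 _) y5 D5).
  have := red (7 / 5) (7 / 5 * x / 2) _ xp _ erefl.
  rewrite mul1r divr1 expRN k7 bin2 /= expr1; apply; first by lra.
  by rewrite (_ : 1`! = 1)%N //; lra.
- have D5 := D_le _ (ball_bound3 R).
  have D20 : 81 / 4 <= D.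
    by apply: le_trans aD; rewrite /minkowski_const (_ : 3`! = 6)%N //; lra.
  have xp : 0 < x by apply: x_pos; lra.
  pose w := expR (x / 5).
  have w5 : expR x = w ^+ 5 by rewrite -expRM_natl; congr expR; field.
  have w4 : expR (12 / 5 * x / 3) = w ^+ 4 by rewrite -expRM_natl; congr expR; field.
  have w2 : expR (12 / 5 * x / 3 / 2) = w ^+ 2 by rewrite -expRM_natl; congr expR; field.
  rewrite w5 in D5.
  apply: (degree3_contra (expR_gt0 _) D20 D5).
  have := red (12 / 5) (12 / 5 * x / 3) _ xp _ erefl.
  rewrite expRN w4 w2 (_ : 'C(3, 2) = 3)%N //; apply; first by lra.
  by rewrite (_ : 2`! = 2)%N //; lra.
have D5 := D_le _ (ball_bound4 R).
have D113 : 1024 / 9 <= D.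
  by apply: le_trans aD; rewrite /minkowski_const (_ : 4`! = 24)%N //; lra.
have xp : 0 < x by apply: x_pos; lra.
pose z := expR (x / 2).
have z2 : expR x = z ^+ 2 by rewrite -expRM_natl; congr expR; field.
have z7 : expR (7 / 2 * x / 4) ^+ 4 = z ^+ 7.
  by rewrite -!expRM_natl; congr expR; field.
rewrite z2 in D5.
apply: (degree4_contra (expR_gt0 _) D113 D5).
have := red (7 / 2) (7 / 2 * x / 4) _ xp _ erefl.
rewrite (_ : 'C(4, 2) = 6)%N // -/z -z7 => le_red.
apply: le_trans (le_red _ _); last 2 first.
- by lra.
- by rewrite (_ : 3`! = 6)%N //; lra.
by apply: exprn_le; rewrite ?expR_ge0 // lerDl mulr_ge0 ?expR_ge0.
Qed.
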